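(* Let $R$ be a commutative ring with unit containing $\mathbb{Q}$, $n\ge1$, and let $F=(F_i)_{1\le i\le n}$ be a system of power series in $R[[X_1,\ldots,X_n]]$ without constant term, whose linear part has matrix $A=\left(\frac{\partial F_i}{\partial X_j}(0)\right)_{1\le i,j\le n}\in GL_n(R)$. Write $F_i(X)=\sum_{j=1}^nA_{ij}X_j-H_i(X)$, where $H_i$ contains only terms of degree at least $2$. Then the compositional inverse $F^{-1}$ of $F$ satisfies in the ring $R[[Y]]=R[[Y_1,\ldots,Y_n]]$, for $1\le i\le n$, the equation $$(F^{-1})_i(Y)=\frac{\int d\bar u\,du\ e^{-\bar uAu}\ u_i\,e^{\bar uH(u)+\bar uY}}{\int d\bar u\,du\ e^{-\bar uAu}\ e^{\bar uH(u)+\bar uY}},$$ the denominator being invertible in $R[[Y]]$. Here the integrals are formal Gaussian integrals with covariance $A^{-1}$.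
   Context: $\bar u=(\bar u_1,\ldots,\bar u_n)$, $u=(u_1,\ldots,u_n)$, $Y=(Y_1,\ldots,Y_n)$ are vectors of indeterminates; $\bar uH(u)=\sum_i\bar u_iH_i(u)$, $\bar uY=\sum_i\bar u_iY_i$. Formal Gaussian integral with covariance $A^{-1}$. Write $[k]=\{1,\ldots,k\}$. For multiindices $\alpha_1,\alpha_2\in\mathbb N^n$, $$\int d\bar u\,du\ e^{-\bar uAu}\ \bar u^{\alpha_1}u^{\alpha_2}=(\det A)^{-1}\sum_\sigma\prod_{k=1}^{k_1}[A^{-1}]_{\tau_2(\sigma(k))\,\tau_1(k)}\in R,$$ where $k_r=|\alpha_r|$, $\tau_r:[k_r]\to[n]$ is any map taking each value $i$ exactly $(\alpha_r)_i$ times, and the sum is over all bijections $\sigma:[k_1]\to[k_2]$ (so the result is $0$ if $k_1\ne k_2$; it is independent of the choice of $\tau_1,\tau_2$). For $U=\sum_{\alpha_1,\alpha_2,\alpha_3\in\mathbb N^n}\frac{u_{\alpha_1,\alpha_2,\alpha_3}}{\alpha_1!\alpha_2!\alpha_3!}\bar u^{\alpha_1}u^{\alpha_2}Y^{\alpha_3}\in R[[\bar u,u,Y]]$, $$\int d\bar u\,du\ e^{-\bar uAu}\ U=\sum_{\alpha_1,\alpha_2,\alpha_3}\frac{u_{\alpha_1,\alpha_2,\alpha_3}Y^{\alpha_3}}{\alpha_1!\alpha_2!\alpha_3!}\int d\bar u\,du\ e^{-\bar uAu}\ \bar u^{\alpha_1}u^{\alpha_2}\in R[[Y]],$$ provided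 that for each $\alpha_3$ only finitely many $(\alpha_1,\alpha_2)$ give a nonzero contribution. The integral sign is only notation for this definition. *)

(* Defs.v *)
From HB Require Import structures.
From mathcomp Require Import all_boot all_order all_algebra.
From mathcomp Require Import all_fingroup mpoly.
From mathcomp Require Import boolp classical_sets cardinality fsbigop.

Set Implicit Arguments.
Unset Strict Implicit.
Unset Printing Implicit Defensive.

Import GRing.Theory.
Local Open Scope ring_scope.

(* A power series is an arbitrary coefficient function on multi-indices; the
   wrapper keeps the Cauchy product apart from the pointwise product that
   function types may carry. *)
Record fps (n : nat) (R : Type) := Fps { fps_coef :> 'X_{1..n} -> R }.

Notation "{ 'fps' R [ n ] }" := (fps n R)
  (at level 0, R, n at level 2, format "{ 'fps'  R [ n ] }").

Lemma fpsP (n : nat) (R : Type) (f g : {fps R[n]}) :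
  (forall m, f m = g m) <-> f = g.
Proof.
split=> [|-> //]; case: f g => [f] [g] /= fg.
by congr Fps; apply: funext.
Qed.

HB.instance Definition _ (n : nat) (R : Type) := gen_eqMixin {fps R[n]}.
HB.instance Definition _ (n : nat) (R : Type) := gen_choiceMixin {fps R[n]}.

Section Zmodule.
Variables (n : nat) (R : nzRingType).
Implicit Types f g : {fps R[n]}.

Definition fps_zero : {fps R[n]} := Fps (fun=> 0).
Definition fps_opp f : {fps R[n]} := Fps (fun m => - f m).
Definition fps_add f g : {fps R[n]} := Fps (fun m => f m + g m).

Fact fps_addA : associative fps_add.
Proof. by move=> f g h; apply/fpsP=> m /=; rewrite addrA. Qed.
Fact fps_addC : commutative fps_add.
Proof. by move=> f g; apply/fpsP=> m /=; rewrite addrC. Qed.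
Fact fps_add0 : left_id fps_zero fps_add.
Proof. by move=> f; apply/fpsP=> m /=; rewrite add0r. Qed.
Fact fps_addN : left_inverse fps_zero fps_opp fps_add.
Proof. by move=> f; apply/fpsP=> m /=; rewrite addNr. Qed.

HB.instance Definition _ := GRing.isZmodule.Build {fps R[n]}
  fps_addA fps_addC fps_add0 fps_addN.

Definition fps_scale (c : R) f : {fps R[n]} := Fps (fun m => c * f m).

Fact fps_scaleA a b f : fps_scale a (fps_scale b f) = fps_scale (a * b) f.
Proof. by apply/fpsP=> m /=; rewrite mulrA. Qed.
Fact fps_scale1 : left_id 1 fps_scale.
Proof. by move=> f; apply/fpsP=> m /=; rewrite mul1r. Qed.
Fact fps_scaleDr : right_distributive fps_scale +%R.
Proof. by move=> a f g; apply/fpsP=> m /=; rewrite mulrDr. Qed.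
Fact fps_scaleDl f : {morph fps_scale^~ f : a b / a + b}.
Proof. by move=> a b; apply/fpsP=> m /=; rewrite mulrDl. Qed.

HB.instance Definition _ := GRing.Zmodule_isLmodule.Build R {fps R[n]}
  fps_scaleA fps_scale1 fps_scaleDr fps_scaleDl.

End Zmodule.

Section Ring.
Variables (n : nat) (R : comNzRingType).
Implicit Types f g : {fps R[n]}.

(* Cauchy product, with the same index set as [mcoeffM]. *)
Definition fps_mul f g : {fps R[n]} := Fps (fun m =>
  \sum_(k : 'X_{1..n < (mdeg m).+1, (mdeg m).+1} | m == (k.1 + k.2)%MM)
    f k.1 * g k.2).

Definition fps_one : {fps R[n]} := Fps (fun m => (m == 0%MM)%:R).

Definition fps_trunc d f : {mpoly R[n]} :=
  \sum_(m : 'X_{1..n < d}) f m *: 'X_[m].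

Lemma coef_trunc d f m : (fps_trunc d f)@_m = if (mdeg m < d)%N then f m else 0.
Proof.
rewrite /fps_trunc raddf_sum /=; case: ltnP => md.
  rewrite (bigD1 (BMultinom md)) //= mcoeffZ mcoeffX eqxx mulr1 big1 ?addr0 //.
  move=> i ne; rewrite mcoeffZ mcoeffX; case: eqP => [e|_]; last by rewrite mulr0.
  by case/eqP: ne; apply/val_inj.
rewrite big1 // => i _; rewrite mcoeffZ mcoeffX; case: eqP => [e|_].
  by move: (bmdeg i); rewrite e ltnNge md.
by rewrite mulr0.
Qed.

Lemma coefM_trunc d f g m : (mdeg m < d)%N ->
  fps_mul f g m = (fps_trunc d f * fps_trunc d g)@_m.
Proof.
move=> md; rewrite mcoeffM; apply: eq_bigr => /= k /eqP mk.
have: (mdeg (k.1 + k.2)%MM < d)%N by rewrite -mk.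
rewrite mdegD => kd.
by rewrite !coef_trunc (leq_ltn_trans (leq_addr _ _) kd)
  (leq_ltn_trans (leq_addl _ _) kd).
Qed.

Lemma fps_trunc_eq d (p q : {mpoly R[n]}) (p' q' : {mpoly R[n]}) m :
  (forall m, (mdeg m < d)%N -> p@_m = p'@_m) ->
  (forall m, (mdeg m < d)%N -> q@_m = q'@_m) ->
  (mdeg m < d)%N -> (p * q)@_m = (p' * q')@_m.
Proof.
move=> hp hq md; rewrite !mcoeffM; apply: eq_bigr => k /eqP mk.
have: (mdeg (k.1 + k.2)%MM < d)%N by rewrite -mk.
rewrite mdegD => kd.
by rewrite hp ?hq // (leq_ltn_trans _ kd) ?leq_addr ?leq_addl.
Qed.

Fact fps_mulC : commutative fps_mul.
Proof.
move=> f g; apply/fpsP=> m.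
by rewrite !(@coefM_trunc (mdeg m).+1) // mulrC.
Qed.

Fact fps_mulA : associative fps_mul.
Proof.
move=> f g h; apply/fpsP=> m; set d := (mdeg m).+1.
rewrite !(@coefM_trunc d) //.
rewrite (@fps_trunc_eq d _ _ (fps_trunc d f) (fps_trunc d g * fps_trunc d h)) //;
  last by move=> k kd; rewrite coef_trunc kd (coefM_trunc _ _ kd).
rewrite mulrA; apply: (@fps_trunc_eq d) => // k kd.
by rewrite coef_trunc kd (coefM_trunc _ _ kd).
Qed.

Fact fps_mul1 : left_id fps_one fps_mul.
Proof.
move=> f; apply/fpsP=> m; rewrite (@coefM_trunc (mdeg m).+1) //.
rewrite (_ : fps_trunc _ fps_one = 1) ?mul1r ?coef_trunc ?ltnSn //.
apply/mpolyP=> k; rewrite coef_trunc mcoeff1 /=.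
by case: ltnP => // dk; case: eqP dk => // ->; rewrite mdeg0.
Qed.

Fact fps_mulDl : left_distributive fps_mul +%R.
Proof.
move=> f g h; apply/fpsP=> m /=; rewrite -big_split /=.
by apply: eq_bigr => k _; rewrite mulrDl.
Qed.

Fact fps_one_neq0 : fps_one != 0.
Proof. by apply/eqP => /fpsP /(_ 0%MM) /= /eqP; rewrite eqxx oner_eq0. Qed.

HB.instance Definition _ := GRing.Zmodule_isComNzRing.Build {fps R[n]}
  fps_mulA fps_mulC fps_mul1 fps_mulDl fps_one_neq0.

Definition fps_unit : pred {fps R[n]} := fun f => `[< exists g, g * f = 1 >].
Definition fps_inv f : {fps R[n]} :=
  if pselect (exists g, g * f = 1) is left h then projT1 (cid h) else f.

Fact fps_mulV : {in fps_unit, left_inverse 1 fps_inv *%R}.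
Proof.
by move=> f /asboolP h; rewrite /fps_inv; case: pselect => // ?; case: cid.
Qed.
Fact fps_unitP f g : g * f = 1 -> fps_unit f.
Proof. by move=> h; apply/asboolP; exists g. Qed.
Fact fps_inv_out : {in [predC fps_unit], fps_inv =1 id}.
Proof.
move=> f; rewrite inE => /negP h; rewrite /fps_inv; case: pselect => // h'.
by case: h; apply/asboolP.
Qed.

HB.instance Definition _ := GRing.ComNzRing_hasMulInverse.Build {fps R[n]}
  fps_mulV fps_unitP fps_inv_out.

Definition fpsX (i : 'I_n) : {fps R[n]} := Fps (fun m => (m == U_(i)%MM)%:R).

Definition fps_deriv (i : 'I_n) f : {fps R[n]} :=
  Fps (fun m => f (m + U_(i))%MM *+ (m i).+1).

End Ring.

Arguments fpsX {n R} i.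

(* f(G_1, ..., G_n). Meaningful only if no G_i has a constant term: then G^a
   has order at least |a|, so that the multi-indices a with |a| > |m| do not
   contribute to the coefficient of index m. *)
Definition fps_comp (n p : nat) (R : comNzRingType)
    (f : {fps R[n]}) (G : 'I_n -> {fps R[p]}) : {fps R[p]} :=
  Fps (fun m => \sum_(a : 'X_{1..n < (mdeg m).+1})
                  f a * (\prod_(i < n) G i ^+ a i) m).

(* Meaningful only if f has no constant term: then f ^+ k has order at least k,
   so that the powers with k > |m| do not contribute to the coefficient of
   index m. *)
Definition fps_exp (n : nat) (R : comUnitRingType) (f : {fps R[n]}) :
    {fps R[n]} :=
  Fps (fun m => \sum_(k < (mdeg m).+1) (k`!%:R)^-1 * (f ^+ k) m).

Definition compositional_inverse (n : nat) (R : comNzRingType)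
    (F G : 'I_n -> {fps R[n]}) : Prop :=
  [/\ forall i, G i 0%MM = 0,
      forall i, fps_comp (F i) G = fpsX i &
      forall i, fps_comp (G i) F = fpsX i].

Definition jacobian0 (n : nat) (R : comNzRingType)
    (F : 'I_n -> {fps R[n]}) : 'M[R]_n :=
  \matrix_(i, j) fps_deriv j (F i) 0%MM.

(* R[[ubar, u, Y]] is {fps R[n + (n + n)]}, with the variables in this order. *)
Section Variables3.
Variables (n : nat) (R : comNzRingType).

Definition ubar (i : 'I_n) : {fps R[n + (n + n)]} := fpsX (lshift (n + n) i).
Definition uvar (i : 'I_n) : {fps R[n + (n + n)]} :=
  fpsX (rshift n (lshift n i)).
Definition Yvar (i : 'I_n) : {fps R[n + (n + n)]} :=
  fpsX (rshift n (rshift n i)).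

Definition mnm3 (a1 a2 a3 : 'X_{1..n}) : 'X_{1..n + (n + n)} :=
  Multinom (cat_tuple a1 (cat_tuple a2 a3)).

End Variables3.

Arguments ubar {n R} i.
Arguments uvar {n R} i.
Arguments Yvar {n R} i.

(* A map taking each value i exactly (a i) times, namely in increasing order. *)
Definition mnm_enum (n : nat) (a : 'X_{1..n}) : 'I_(mdeg a) -> 'I_n :=
  tnth (Tuple (introT eqP (size_m2s a))).

Arguments mnm_enum {n} a k.

Lemma card_mnm_enum (n : nat) (a : 'X_{1..n}) (i : 'I_n) :
  #|[set k | mnm_enum a k == i]| = a i.
Proof.
rewrite -[in RHS](s2mK a) /s2m mnmE -[in RHS]/(tval (Tuple (introT eqP (size_m2s a)))).
rewrite cardsE -sum1_card -sum1_count [RHS]big_tuple.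
by apply: eq_bigl => k; rewrite /in_mem.
Qed.

Lemma enum_perm (n k : nat) (t t' : 'I_k -> 'I_n) :
  (forall i, #|[set j | t j == i]| = #|[set j | t' j == i]|) ->
  exists p : {perm 'I_k}, forall j, t' j = t (p j).
Proof.
move=> h; have ct (f : 'I_k -> 'I_n) i :
    count_mem i [tuple f j | j < k] = #|[set j | f j == i]|.
  rewrite cardsE -sum1_card -sum1_count big_tuple.
  by apply: eq_bigl => j; rewrite tnth_mktuple /in_mem.
have /tuple_permP[p /val_inj e] :
    perm_eq [tuple t' j | j < k] [tuple t j | j < k].
  by apply/allP => i _ /=; rewrite !ct h.
exists p => j; have := congr1 (fun u => tnth u j) e.
by rewrite !tnth_mktuple.
Qed.

Section Gauss.
Variables (n : nat) (R : comUnitRingType).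
Implicit Types (A : 'M[R]_n) (U : {fps R[n + (n + n)]}).

Definition gauss_moment_of A (k1 k2 : nat)
    (t1 : 'I_k1 -> 'I_n) (t2 : 'I_k2 -> 'I_n) : R :=
  (\det A)^-1 *
  \sum_(s : {ffun 'I_k1 -> 'I_k2} | `[< bijective s >])
    \prod_(k < k1) invmx A (t2 (s k)) (t1 k).

Definition gauss_moment A (a1 a2 : 'X_{1..n}) : R :=
  gauss_moment_of A (mnm_enum a1) (mnm_enum a2).

Lemma gauss_moment_indep A (a1 a2 : 'X_{1..n})
    (t1 : 'I_(mdeg a1) -> 'I_n) (t2 : 'I_(mdeg a2) -> 'I_n) :
  (forall i, #|[set k | t1 k == i]| = a1 i) ->
  (forall i, #|[set k | t2 k == i]| = a2 i) ->
  gauss_moment_of A t1 t2 = gauss_moment A a1 a2.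
Proof.
move=> h1 h2; rewrite /gauss_moment.
have [p1 e1] := enum_perm (fun i => etrans (card_mnm_enum a1 i) (esym (h1 i))).
have [p2 e2] := enum_perm (fun i => etrans (card_mnm_enum a2 i) (esym (h2 i))).
rewrite /gauss_moment_of; congr (_ * _).
pose c (s : {ffun 'I_(mdeg a1) -> 'I_(mdeg a2)}) :=
  [ffun k => (p2^-1)%g (s (p1 k))].
pose d (s : {ffun 'I_(mdeg a1) -> 'I_(mdeg a2)}) :=
  [ffun k => p2 (s ((p1^-1)%g k))].
have cd : cancel d c.
  by move=> s; apply/ffunP=> k; rewrite !ffunE permK permK.
have dc : cancel c d.
  by move=> s; apply/ffunP=> k; rewrite !ffunE permKV permKV.
have bij_d s : `[< bijective (d s) >] = `[< bijective s >].
  apply/asboolP/asboolP => b.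
    suff -> : (s : _ -> _) = ((p2^-1)%g \o d s) \o p1.
      by apply: bij_comp; [apply: bij_comp => //|]; apply: injF_bij; apply: perm_inj.
    by apply: funext => k /=; rewrite ffunE !permK.
  suff -> : (d s : _ -> _) = (p2 \o s) \o (p1^-1)%g.
    by apply: bij_comp; [apply: bij_comp => //|]; apply: injF_bij; apply: perm_inj.
  by apply: funext => k /=; rewrite ffunE.
rewrite [RHS](reindex d) /=; last by exists c => s _; [exact: cd|exact: dc].
rewrite [RHS](eq_bigl (fun s : {ffun _ -> _} => `[< bijective s >])) //.
apply: eq_bigr => s _; rewrite [RHS](reindex p1) /=; last first.
  by apply: onW_bij; apply: injF_bij; apply: perm_inj.
by apply: eq_bigr => k _; rewrite e1 !ffunE e2 permK.
Qed.

(* The coefficient of U at ubar^a1 u^a2 Y^a3 is u_(a1,a2,a3)/(a1! a2! a3!). *)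
Definition gauss_term A U (a3 : 'X_{1..n}) (a : 'X_{1..n} * 'X_{1..n}) : R :=
  U (mnm3 a.1 a.2 a3) * gauss_moment A a.1 a.2.

Definition gauss_integrable A U : Prop :=
  forall a3, finite_set [set a | gauss_term A U a3 a != 0]%classic.

(* Finitely supported sum, which is 0 if the support is infinite, hence
   meaningful only if U is integrable. *)
Definition gauss_integral A U : {fps R[n]} :=
  Fps (fun a3 => \sum_(a \in [set: 'X_{1..n} * 'X_{1..n}]%classic)
                   gauss_term A U a3 a).

End Gauss.

(* Main.v *)
From HB Require Import structures.
Require Import Defs.
From mathcomp Require Import all_boot all_order all_algebra.
From mathcomp Require Import all_fingroup finmap zify.
From mathcomp Require Import boolp classical_sets cardinality fsbigop.
From mathcomp Require Import mpoly.

(* With W = exp(ubar H(u) + ubar Y), let E(P) denote the Gaussian integral of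
   P(u) W, for P in R[[X]].  Expanding the permanents in the moments along a
   row gives the integration by parts formula
     int u_j U = sum_k (A^-1)_jk int dU/dubar_k,
   hence int (A u)_i U = int dU/dubar_i.  As P(u) is free of ubar and
   dW/dubar_i = (H_i(u) + Y_i) W, this says E(F_i P) = Y_i E(P).  By linearity
   and continuity E(g o F) = g E(1) for every power series g, and g = (F^-1)_i
   gives E(X_i) = (F^-1)_i E(1).  The constant term of E(1) is (det A)^-1, so
   that E(1) is invertible.
   The inverse of F is found by reducing to the case F = X + higher terms, in
   which f - f o F always has larger order than f, so that f |-> f o F is
   bijective. *)

Set Implicit Arguments.
Unset Strict Implicit.
Unset Printing Implicit Defensive.

Import GRing.Theory.
Local Open Scope ring_scope.

(** * Power series: congruences and composition *)

Section Algebra.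
Variables (n : nat) (R : comNzRingType).
Implicit Types (f g : {fps R[n]}) (m : 'X_{1..n}).

Lemma fps_coefM f g m : (f * g) m =
  \sum_(k : 'X_{1..n < (mdeg m).+1, (mdeg m).+1} | m == (k.1 + k.2)%MM)
    f k.1 * g k.2.
Proof. by []. Qed.

Fact fps_scaleAl (c : R) f g : c *: (f * g) = (c *: f) * g.
Proof.
apply/fpsP => m; rewrite fps_coefM /= big_distrr /=.
by apply: eq_bigr => k _; rewrite mulrA.
Qed.

(** The algebra structure provides [in_alg], the embedding of constants with which [mmap] evaluates
    polynomials at power series. *)
HB.instance Definition _ :=
  GRing.Lmodule_isLalgebra.Build R {fps R[n]} fps_scaleAl.

Fact fps_scaleAr (c : R) f g : c *: (f * g) = f * (c *: g).
Proof. by rewrite mulrC scalerAl mulrC. Qed.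

HB.instance Definition _ :=
  GRing.Lalgebra_isAlgebra.Build R {fps R[n]} fps_scaleAr.

Lemma fps_coefD f g m : (f + g) m = f m + g m. Proof. by []. Qed.
Lemma fps_coefB f g m : (f - g) m = f m - g m. Proof. by []. Qed.
Lemma fps_coefZ (c : R) f m : (c *: f) m = c * f m. Proof. by []. Qed.
Lemma fps_coef1 m : (1 : {fps R[n]}) m = (m == 0%MM)%:R. Proof. by []. Qed.

Lemma fps_coef_sum (I : Type) (r : seq I) (P : pred I) (F : I -> {fps R[n]}) m :
  (\sum_(i <- r | P i) F i) m = \sum_(i <- r | P i) F i m.
Proof. by apply: (big_morph (fun f : {fps R[n]} => f m)). Qed.

Lemma fps_coefM0 f g : (f * g) 0%MM = f 0%MM * g 0%MM.
Proof.
have -> : (f * g) 0%MM = (fps_trunc 1 f * fps_trunc 1 g)@_0.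
  by apply: coefM_trunc; rewrite mdeg0.
by rewrite rmorphM /= !coef_trunc mdeg0.
Qed.

Lemma fps_coefXM (i : 'I_n) f m :
  (fpsX i * f) m = if (0 < m i)%N then f (m - U_(i))%MM else 0.
Proof.
(* The bound |m| + 2, rather than |m| + 1, keeps X_i in the truncation even when m = 0. *)
have -> : (fpsX i * f) m = (fps_trunc (mdeg m).+2 f * 'X_i)@_m.
  have /coefM_trunc -> : (mdeg m < (mdeg m).+2)%N by [].
  rewrite mulrC; congr (_ * _)@_m; apply/mpolyP => k.
  rewrite coef_trunc mcoeffX eq_sym /=; case: ltnP => // mk.
  by case: eqP mk => // ->; rewrite mdeg1.
set q := fps_trunc _ f; case: ltnP => [mi|].
  have {1}-> : m = (m - U_(i) + U_(i))%MM by rewrite submK // lep1mP -lt0n.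
  rewrite addmC mcoeffMX coef_trunc.
  by rewrite (leq_ltn_trans (mdegB _ _)).
rewrite leqn0 => /eqP mi; rewrite mcoeffMr big1 //.
move=> -[[a /= _] [b /= _]] /eqP mab.
rewrite mcoeffX; case: eqP => [ub|]; last by rewrite mulr0.
by move: mi; rewrite mab mnmDE -ub mnm1E eqxx.
Qed.

End Algebra.

(** * Supports, orders and congruences of power series *)

Section Congruence.
Variables (n : nat) (R : comNzRingType).
Implicit Types (f g : {fps R[n]}) (m : 'X_{1..n}) (Q : pred 'X_{1..n}).

(** One notion covers all the conditions on exponents used below: order at least d, freeness of a
    variable, dependence on u alone, and balance. Closure of Q under addition makes it pass to
    products, powers and compositions. *)
Definition supported Q f := forall m, ~~ Q m -> f m = 0.

Definition order_ge d := supported (fun m => d <= mdeg m)%N.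

(** Congruence modulo the d-th power of the ideal generated by the variables. *)
Definition fps_cong d f g := forall m, (mdeg m < d)%N -> f m = g m.

Lemma supportedW Q Q' f : (forall m, Q m -> Q' m) ->
  supported Q f -> supported Q' f.
Proof. by move=> h hf m nQ; apply: hf; apply: contra nQ; apply: h. Qed.

Lemma supported0 Q : supported Q 0.
Proof. by []. Qed.

Lemma supportedD Q f g : supported Q f -> supported Q g -> supported Q (f + g).
Proof. by move=> hf hg m nQ; rewrite fps_coefD hf ?hg ?addr0. Qed.

Lemma supportedZ Q c f : supported Q f -> supported Q (c *: f).
Proof. by move=> hf m nQ; rewrite fps_coefZ hf ?mulr0. Qed.

Lemma supported_sum Q (I : Type) (r : seq I) (P : pred I) F :
  (forall i, P i -> supported Q (F i)) -> supported Q (\sum_(i <- r | P i) F i).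
Proof.
by move=> h; elim/big_ind: _ => //; apply: supportedD.
Qed.

Lemma supportedM Q1 Q2 Q f g : (forall a b, Q1 a -> Q2 b -> Q (a + b)%MM) ->
  supported Q1 f -> supported Q2 g -> supported Q (f * g).
Proof.
move=> QM hf hg m nQ; rewrite fps_coefM big1 // => k /eqP mk.
have [q1|/hf ->] := boolP (Q1 k.1); last by rewrite mul0r.
have [q2|/hg ->] := boolP (Q2 k.2); last by rewrite mulr0.
by rewrite mk QM in nQ.
Qed.

Lemma supportedX Q i : Q U_(i)%MM -> supported Q (fpsX i).
Proof. by move=> h m nQ /=; case: eqP => // e; rewrite e h in nQ. Qed.

Section Closed.
Variable Q : pred 'X_{1..n}.
Hypotheses (Q0 : Q 0%MM) (QD : forall a b, Q a -> Q b -> Q (a + b)%MM).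

Lemma supported1 : supported Q 1.
Proof.
by move=> m nQ; rewrite fps_coef1; case: eqP nQ => // ->; rewrite Q0.
Qed.

Lemma supported_prod (I : Type) (r : seq I) (P : pred I) F :
  (forall i, P i -> supported Q (F i)) ->
  supported Q (\prod_(i <- r | P i) F i).
Proof.
move=> h; elim/big_ind: _ => //; first exact: supported1.
by move=> f g; apply: supportedM.
Qed.

Lemma supported_expr f k : supported Q f -> supported Q (f ^+ k).
Proof.
by move=> h; rewrite -[k]card_ord -prodr_const; apply: supported_prod.
Qed.

Lemma supported_comp p (f : {fps R[p]}) K :
  (forall i, supported Q (K i)) -> supported Q (fps_comp f K).
Proof.
move=> h m nQ; rewrite /= big1 // => a _.
suff /(_ m nQ) -> : supported Q (\prod_(i < p) K i ^+ a i) by rewrite mulr0.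
by apply: supported_prod => i _; apply: supported_expr.
Qed.

End Closed.

Lemma order_geM d e f g :
  order_ge d f -> order_ge e g -> order_ge (d + e) (f * g).
Proof. by apply: supportedM => a b; rewrite mdegD; apply: leq_add. Qed.

Lemma order_geMr d f g : order_ge d f -> order_ge d (f * g).
Proof. by move=> h; rewrite -[d]addn0; apply: order_geM. Qed.

Lemma order_geW d e f : (d <= e)%N -> order_ge e f -> order_ge d f.
Proof. by move=> de; apply: supportedW => m; apply: leq_trans. Qed.

Lemma order_ge_prod (I : Type) (r : seq I) (P : pred I) (d : I -> nat) F :
  (forall i, P i -> order_ge (d i) (F i)) ->
  order_ge (\sum_(i <- r | P i) d i) (\prod_(i <- r | P i) F i).
Proof.
move=> h; elim/big_rec2: _ => [m|i e f Pi hf]; first by rewrite leq0n.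
exact: order_geM (h i Pi) hf.
Qed.

Lemma order_ge_expr d f k : order_ge d f -> order_ge (k * d) (f ^+ k).
Proof.
move=> h; rewrite -[k]card_ord -sum_nat_const -prodr_const.
exact: order_ge_prod.
Qed.

Lemma order_ge_const f : f 0%MM = 0 -> order_ge 1 f.
Proof. by move=> f0 m; rewrite -ltnNge ltnS leqn0 mdeg_eq0 => /eqP ->. Qed.

Lemma order_ge_eq0 f : (forall d, order_ge d f) -> f = 0.
Proof. by move=> h; apply/fpsP => m; apply: (h (mdeg m).+1); rewrite ltnn. Qed.

Lemma fps_cong_sym d f g : fps_cong d f g -> fps_cong d g f.
Proof. by move=> h m md; rewrite h. Qed.

Lemma fps_cong_trans d f g h :
  fps_cong d f g -> fps_cong d g h -> fps_cong d f h.
Proof. by move=> e1 e2 m md; rewrite e1 ?e2. Qed.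

Lemma fps_congW d e f g : (d <= e)%N -> fps_cong e f g -> fps_cong d f g.
Proof. by move=> de h m md; apply: h; apply: leq_trans de. Qed.

Lemma fps_congD d f g f' g' :
  fps_cong d f f' -> fps_cong d g g' -> fps_cong d (f + g) (f' + g').
Proof. by move=> e1 e2 m md; rewrite !fps_coefD e1 ?e2. Qed.

Lemma fps_congM d f g f' g' :
  fps_cong d f f' -> fps_cong d g g' -> fps_cong d (f * g) (f' * g').
Proof.
move=> e1 e2 m md; rewrite !fps_coefM; apply: eq_bigr => k /eqP mk.
have kd : (mdeg k.1 + mdeg k.2 < d)%N by rewrite -mdegD -mk.
by rewrite e1 ?e2 // (leq_ltn_trans _ kd) ?leq_addr ?leq_addl.
Qed.

Lemma fps_congP f g : (forall d, fps_cong d f g) -> f = g.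
Proof. by move=> h; apply/fpsP => m; apply: (h (mdeg m).+1). Qed.

Lemma order_ge_sub d f g : fps_cong d f g -> order_ge d (f - g).
Proof. by move=> h m; rewrite -ltnNge fps_coefB => /h ->; rewrite subrr. Qed.

Lemma fps_cong_sub d f g : order_ge d (f - g) -> fps_cong d f g.
Proof.
by move=> h m; rewrite ltnNge => /h /eqP; rewrite fps_coefB subr_eq0 => /eqP.
Qed.

End Congruence.

(** * Composition of power series, reduced to substitution in polynomials *)

Section Composition.
Variable R : comNzRingType.

Section Substitution.
Variables (n p : nat) (K : 'I_n -> {fps R[p]}).
Implicit Types (f g : {fps R[n]}) (q : {mpoly R[n]}).
Implicit Types (a : 'X_{1..n}) (m : 'X_{1..p}).

(** On polynomials substitution is a ring morphism whatever the constant terms of the K_i;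
    identities for series are derived from it by truncation. *)
Definition subst : {mpoly R[n]} -> {fps R[p]} := mmap (in_alg {fps R[p]}) K.

HB.instance Definition _ := GRing.RMorphism.copy subst
  (mmap (in_alg {fps R[p]}) K).

Lemma substE q : subst q = \sum_(a <- msupp q) q@_a *: mmap1 K a.
Proof. by apply: eq_bigr => a _; rewrite /= mulr_algl. Qed.

Lemma subst_monomial a : subst 'X_[a] = mmap1 K a.
Proof. exact: mmapX. Qed.

Lemma subst_scale c q : subst (c *: q) = c *: subst q.
Proof. by rewrite /subst mmapZ /= mulr_algl. Qed.

Lemma subst_trunc d f :
  subst (fps_trunc d f) = \sum_(a : 'X_{1..n < d}) f a *: mmap1 K a.
Proof.
rewrite /fps_trunc raddf_sum /=; apply: eq_bigr => a _.
by rewrite subst_scale subst_monomial.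
Qed.

Lemma fps_comp_coef f m : fps_comp f K m = subst (fps_trunc (mdeg m).+1 f) m.
Proof. by rewrite subst_trunc fps_coef_sum. Qed.

Hypothesis K0 : forall i, K i 0%MM = 0.

Lemma order_ge_mmap1 a : order_ge (mdeg a) (mmap1 K a).
Proof.
rewrite mdegE /mmap1; apply: order_ge_prod => i _.
by have := order_ge_expr (k := a i) (order_ge_const (K0 i)); rewrite muln1.
Qed.

Lemma order_ge_subst d q : (forall a, (mdeg a < d)%N -> q@_a = 0) ->
  order_ge d (subst q).
Proof.
move=> q0; rewrite substE; apply: supported_sum => a _.
have [/q0 ->|da] := ltnP (mdeg a) d.
  by rewrite scale0r; apply: supported0.
by apply: supportedZ; apply: (order_geW da); apply: order_ge_mmap1.
Qed.

(** As the K_i have no constant term, monomials of degree at least d only produce terms of order at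
    least d, so any polynomial that agrees with f below degree d may stand for f. *)
Lemma fps_comp_subst d f q : (forall a, (mdeg a < d)%N -> q@_a = f a) ->
  fps_cong d (fps_comp f K) (subst q).
Proof.
move=> qf m md; rewrite fps_comp_coef; apply/eqP; rewrite -subr_eq0 -fps_coefB.
rewrite -rmorphB /=; apply/eqP.
apply: (@order_ge_subst (mdeg m).+1); last first.
  by rewrite ltnn.
by move=> a am; rewrite mcoeffB coef_trunc am qf ?subrr // (leq_trans am).
Qed.

Lemma fps_comp_trunc d f : fps_cong d (fps_comp f K) (subst (fps_trunc d f)).
Proof. by apply: fps_comp_subst => a ad; rewrite coef_trunc ad. Qed.

Lemma fps_comp_sum d f :
  fps_cong d (fps_comp f K) (\sum_(a : 'X_{1..n < d}) f a *: mmap1 K a).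
Proof. by rewrite -subst_trunc; apply: fps_comp_trunc. Qed.

Lemma fps_comp_cong d f g :
  fps_cong d f g -> fps_cong d (fps_comp f K) (fps_comp g K).
Proof.
move=> fg; apply: fps_cong_trans (fps_cong_sym (fps_comp_trunc g)).
by apply: fps_comp_subst => a ad; rewrite coef_trunc ad fg.
Qed.

Lemma order_ge_comp d f : order_ge d f -> order_ge d (fps_comp f K).
Proof.
move=> hf m; rewrite -ltnNge => md; rewrite /= big1 // => a _.
by rewrite hf ?mul0r // -ltnNge (leq_trans (bmdeg a)).
Qed.

Lemma fps_compD f g : fps_comp (f + g) K = fps_comp f K + fps_comp g K.
Proof.
apply/fpsP => m /=; rewrite -big_split /=; apply: eq_bigr => a _.
by rewrite mulrDl.
Qed.

Lemma fps_compZ c f : fps_comp (c *: f) K = c *: fps_comp f K.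
Proof.
apply/fpsP => m /=; rewrite big_distrr /=; apply: eq_bigr => a _.
by rewrite mulrA.
Qed.

Lemma fps_compB f g : fps_comp (f - g) K = fps_comp f K - fps_comp g K.
Proof. by rewrite -[- g]scaleN1r fps_compD fps_compZ scaleN1r. Qed.

Lemma fps_comp0 : fps_comp 0 K = 0.
Proof. by rewrite -(subrr 0) fps_compB subrr. Qed.

Lemma fps_comp_sumr (I : Type) (r : seq I) (P : pred I) (F : I -> {fps R[n]}) :
  fps_comp (\sum_(i <- r | P i) F i) K = \sum_(i <- r | P i) fps_comp (F i) K.
Proof.
apply: (big_morph (fun f => fps_comp f K)) => [f g|]; first exact: fps_compD.
exact: fps_comp0.
Qed.

Lemma fps_compM f g : fps_comp (f * g) K = fps_comp f K * fps_comp g K.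
Proof.
apply: fps_congP => d.
apply: fps_cong_trans (fps_congM (fps_cong_sym (fps_comp_trunc f))
  (fps_cong_sym (fps_comp_trunc g))).
rewrite -rmorphM /=; apply: fps_comp_subst => a ad.
by rewrite -(coefM_trunc _ _ ad).
Qed.

Lemma fps_compX i : fps_comp (fpsX i) K = K i.
Proof.
apply: fps_congP => d; rewrite -[K i](mmap1U K) -subst_monomial.
by apply: fps_comp_subst => a _; rewrite mcoeffX eq_sym.
Qed.

Lemma fps_comp1 : fps_comp 1 K = 1.
Proof.
apply: fps_congP => d; rewrite -[X in fps_cong _ _ X](rmorph1 subst).
by apply: fps_comp_subst => a _; rewrite mcoeff1.
Qed.

Lemma fps_comp_const f : fps_comp f K 0%MM = f 0%MM.
Proof.
have /fps_comp_cong h : fps_cong 1 f (f 0%MM *: 1).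
  move=> m; rewrite ltnS leqn0 mdeg_eq0 => /eqP ->.
  by rewrite fps_coefZ fps_coef1 eqxx mulr1.
by rewrite h ?mdeg0 // fps_compZ fps_comp1 fps_coefZ fps_coef1 eqxx mulr1.
Qed.

End Substitution.

(** Induction on the degree, splitting off one variable with a positive exponent. *)
Lemma mmap1_fpsX n (a : 'X_{1..n}) :
  mmap1 (@fpsX n R) a = Fps (fun m => (m == a)%:R).
Proof.
have [d] := ubnP (mdeg a); elim: d a => // d IH a.
have [->|] := eqVneq a 0%MM; first by rewrite mmap11.
move=> a0; have [i ai] : exists i, a i != 0%N.
  apply/existsP; apply: contraNT a0; rewrite negb_exists => /forallP h.
  by apply/eqP/mnmP => i; rewrite mnm0E; apply/eqP; move: (h i); rewrite negbK.
rewrite -(@submK _ U_(i)%MM a) ?lep1mP // mdegD mdeg1 addn1 ltnS => /IH h.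
rewrite commr_mmap1_M; last by move=> *; apply: mulrC.
rewrite mmap1U h mulrC; apply/fpsP => m; rewrite fps_coefXM /=.
have [mi|mi] := ltnP 0 (m i).
  congr (nat_of_bool _)%:R; apply/eqP/eqP => [<-|->]; last by rewrite addmK.
  by rewrite submK // lep1mP -lt0n.
by case: eqP mi => // ->; rewrite mnmDE mnm1E eqxx addn1.
Qed.

Lemma fps_comp_id n (f : {fps R[n]}) : fps_comp f (@fpsX n R) = f.
Proof.
apply/fpsP => m; rewrite fps_comp_coef subst_trunc fps_coef_sum.
rewrite (bigD1 (BMultinom (ltnSn (mdeg m)))) //= mmap1_fpsX /= eqxx mulr1.
rewrite big1 ?addr0 // => a ne; rewrite mmap1_fpsX /=; case: eqP => [e|].
  by case/eqP: ne; apply/val_inj.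
by rewrite mulr0.
Qed.

(** Associativity with a polynomial outside: composition with K is additive and multiplicative, so
    it passes through a finite sum of monomials. Truncation then gives the case of a series. *)
Lemma fps_comp_subst_comp n p q (f : {mpoly R[n]}) (G : 'I_n -> {fps R[p]})
    (K : 'I_p -> {fps R[q]}) : (forall i, K i 0%MM = 0) ->
  fps_comp (subst G f) K = subst (fun i => fps_comp (G i) K) f.
Proof.
move=> K0; rewrite !substE fps_comp_sumr //; apply: eq_bigr => a _.
rewrite fps_compZ //; congr (_ *: _); rewrite /mmap1.
have := big_morph (fun g => fps_comp g K) (fps_compM K0) (fps_comp1 K0).
move=> ->; apply: eq_bigr => i _; elim: (a i) => [|k IH].
  by rewrite fps_comp1.
by rewrite !exprS fps_compM // IH.
Qed.

Lemma fps_compA n p q (f : {fps R[n]}) (G : 'I_n -> {fps R[p]})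
    (K : 'I_p -> {fps R[q]}) :
  (forall i, G i 0%MM = 0) -> (forall i, K i 0%MM = 0) ->
  fps_comp (fps_comp f G) K = fps_comp f (fun i => fps_comp (G i) K).
Proof.
move=> G0 K0; have GK0 i : fps_comp (G i) K 0%MM = 0 by rewrite fps_comp_const.
apply: fps_congP => d.
apply: fps_cong_trans (fps_cong_sym (fps_comp_trunc GK0 f)).
by rewrite -fps_comp_subst_comp //; apply/fps_comp_cong/fps_comp_trunc.
Qed.

End Composition.

(** * Compositional inverses *)

(** Iteration of g |-> b + N g from 0: since N raises orders, the k-th iterate is final below degree
    k, and the limit is read off coefficientwise. *)
Lemma order_raising_fixpoint n (R : comNzRingType)
    (N : {fps R[n]} -> {fps R[n]}) (b : {fps R[n]}) :
  (forall f g, N (f - g) = N f - N g) ->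
  (forall d f, order_ge d f -> order_ge d.+1 (N f)) ->
  exists g, g = b + N g.
Proof.
move=> NB Nord; pose s k := iter k (fun g => b + N g) 0.
have Nmod d f g : fps_cong d f g -> fps_cong d.+1 (b + N f) (b + N g).
  move=> /order_ge_sub /Nord fg; apply: fps_congD => //; apply: fps_cong_sub.
  by rewrite -NB.
have sS k : fps_cong k (s k.+1) (s k) by elim: k => [//|k /Nmod].
have sD k l : fps_cong k (s (k + l)%N) (s k).
  elim: l => [|l IH]; first by rewrite addn0.
  rewrite addnS; apply: fps_cong_trans IH; apply: fps_congW (sS _).
  exact: leq_addr.
(* The iterate of rank |m| + 1 is the first one known to be final in degree |m|. *)
pose g : {fps R[n]} := Fps (fun m => s (mdeg m).+1 m).
have gs k : fps_cong k g (s k).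
  by move=> m mk /=; rewrite -(subnKC mk) sD.
exists g; apply: fps_congP => d.
apply: fps_cong_trans (gs d) _; apply: fps_cong_sym.
apply: fps_cong_trans (sS d).
exact: fps_congW (leqnSn d) (Nmod _ _ _ (gs d)).
Qed.

(** Write f / f(0) = 1 - h with h(0) = 0. The geometric series of h is the solution of g = 1 + h
    g. *)
Lemma fps_unit_const n (R : comUnitRingType) (f : {fps R[n]}) :
  f 0%MM \is a GRing.unit -> f \is a GRing.unit.
Proof.
move=> fu; pose h := 1 - (f 0%MM)^-1 *: f.
have h0 : h 0%MM = 0 by rewrite fps_coefB fps_coef1 eqxx fps_coefZ mulVr ?subrr.
have [|d g|g eg] := @order_raising_fixpoint _ _ (fun g => h * g) 1.
- by move=> u v; rewrite mulrBr.
- by apply: (@order_geM _ _ 1); apply: order_ge_const.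
have gf : ((f 0%MM)^-1 *: g) * f = 1.
  have fh : (f 0%MM)^-1 *: f = 1 - h by rewrite /h opprB addrC subrK.
  by rewrite -scalerAl scalerAr fh mulrBr mulr1 {1}eg mulrC addrK.
by apply/unitrP; exists ((f 0%MM)^-1 *: g); rewrite [f * _]mulrC.
Qed.

(** * Inverses of systems with invertible linear part *)

Section InverseFunction.
Variable R : comNzRingType.

Lemma order_ge_mulB n d e (x y x' y' : {fps R[n]}) :
  order_ge d x -> order_ge e y' ->
  order_ge d.+1 (x - y) -> order_ge e.+1 (x' - y') ->
  order_ge (d + e).+1 (x * x' - y * y').
Proof.
move=> hx hy' hxy hxy'.
rewrite (_ : _ - _ = x * (x' - y') + (x - y) * y'); last first.
  by rewrite mulrBr mulrBl addrA subrK.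
by apply: supportedD; [rewrite -addnS | rewrite -addSn]; apply: order_geM.
Qed.

Lemma order_ge_exprB n k (x y : {fps R[n]}) :
  order_ge 1 x -> order_ge 1 y -> order_ge 2 (x - y) ->
  order_ge k.+1 (x ^+ k - y ^+ k).
Proof.
move=> x1 y1 xy; elim: k => [|k IH]; first by rewrite subrr; apply: supported0.
rewrite !exprS; apply: (@order_ge_mulB _ 1 k) => //.
by have := order_ge_expr (k := k) y1; rewrite muln1.
Qed.

Lemma order_ge_mmap1B n p (x y : 'I_n -> {fps R[p]}) a :
  (forall i, x i 0%MM = 0) -> (forall i, y i 0%MM = 0) ->
  (forall i, order_ge 2 (x i - y i)) ->
  order_ge (mdeg a).+1 (mmap1 x a - mmap1 y a).
Proof.
move=> x0 y0 xy.
have o1 (z : 'I_n -> {fps R[p]}) (z0 : forall i, z i 0%MM = 0) i :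
    order_ge 1 (z i).
  exact: order_ge_const.
have oX (z : 'I_n -> {fps R[p]}) (z0 : forall i, z i 0%MM = 0) i :
    order_ge (a i) (z i ^+ a i).
  by have := order_ge_expr (k := a i) (o1 z z0 i); rewrite muln1.
rewrite mdegE /mmap1.
(* The order of the product of the y_i is carried through the induction because [order_ge_mulB] asks
   for it at each step. *)
suff [] : order_ge (\sum_i a i) (\prod_i y i ^+ a i) /\
  order_ge (\sum_i a i).+1 (\prod_i x i ^+ a i - \prod_i y i ^+ a i) by [].
elim/big_rec3: _ => [|i u v w _ [hu huv]].
  by rewrite subrr; split=> //; apply: supported0.
split; first exact: order_geM (oX _ y0 i) hu.
apply: order_ge_mulB => //; first exact: oX.
by apply: order_ge_exprB; [exact: o1 | exact: o1 | exact: xy].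
Qed.

Lemma fpsX_const n (i : 'I_n) : fpsX i 0%MM = 0 :> R.
Proof. by rewrite /= eq_sym mnm1_eq0. Qed.

(** Both f and f o F have the coefficients of f, against X^a and F^a respectively, and X^a - F^a has
    order greater than |a|. *)
Lemma order_ge_sub_comp n (F : 'I_n -> {fps R[n]}) d f :
  (forall i, F i 0%MM = 0) -> (forall i, order_ge 2 (fpsX i - F i)) ->
  order_ge d f -> order_ge d.+1 (f - fps_comp f F).
Proof.
move=> F0 FX hf; rewrite -{1}[f]fps_comp_id.
have hX i : fpsX i 0%MM = 0 := @fpsX_const n i.
apply: order_ge_sub; apply: fps_cong_trans (fps_comp_sum hX _) _.
apply: fps_cong_trans (fps_cong_sym (fps_comp_sum F0 f)).
apply: fps_cong_sub; rewrite -sumrB; apply: supported_sum => a _.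
rewrite -scalerBr; have [da|/hf ->] := boolP (d <= mdeg a)%N; last first.
  by rewrite scale0r; apply: supported0.
apply: supportedZ; apply: order_geW (order_ge_mmap1B hX F0 FX).
by rewrite ltnS.
Qed.

Lemma near_identity_inverse n (F : 'I_n -> {fps R[n]}) :
  (forall i, F i 0%MM = 0) -> (forall i, order_ge 2 (fpsX i - F i)) ->
  exists G, compositional_inverse F G.
Proof.
move=> F0 FX.
have surj b : exists g, fps_comp g F = b.
  (* A fixed point g = b + (g - g o F) satisfies g o F = b. *)
  have [|d g|g eg] := @order_raising_fixpoint _ _ (fun g => g - fps_comp g F) b.
  - by move=> f g; rewrite fps_compB // !opprD addrACA.
  - exact: order_ge_sub_comp.
  exists g; apply/esym/subr0_eq/(@addrI _ g).
  by rewrite addr0 [RHS]eg addrCA.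
have inj f g : fps_comp f F = fps_comp g F -> f = g.
  (* The difference f - g is killed by composition with F, hence equals its own defect, whose order
     is larger; so its order exceeds every bound. *)
  move=> e; apply/eqP; rewrite -subr_eq0; apply/eqP/order_ge_eq0.
  elim=> [//|d /(order_ge_sub_comp F0 FX)].
  by rewrite fps_compB e subrr subr0.
have /choice[G GF] : forall i, exists g, fps_comp g F = fpsX i.
  by move=> i; apply: surj.
have G0 i : G i 0%MM = 0 by rewrite -(fps_comp_const F0) GF fpsX_const.
(* From G o F = X one gets (F_i o G) o F = F_i = X_i o F, and injectivity gives F_i o G = X_i. *)
exists G; split=> // i; apply: inj; rewrite fps_compA // fps_compX //.
by rewrite (_ : (fun _ => _) = fpsX) ?fps_comp_id //; apply: funext.
Qed.

(** Serves both for the linear change of variables and for cancelling A against A^-1 after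
    integration by parts. *)
Lemma mx_comb_mul (V : lmodType R) n (A B : 'M[R]_n) (v : 'I_n -> V) i :
  \sum_j A i j *: (\sum_k B j k *: v k) = \sum_k (A *m B) i k *: v k.
Proof.
under eq_bigr do rewrite scaler_sumr; rewrite exchange_big /=.
apply: eq_bigr => k _; rewrite mxE scaler_suml.
by apply: eq_bigr => j _; rewrite scalerA.
Qed.

Lemma mx_comb1 (V : lmodType R) n (v : 'I_n -> V) i :
  \sum_k (1%:M : 'M[R]_n) i k *: v k = v i.
Proof.
rewrite (bigD1 i) //= mxE eqxx scale1r big1 ?addr0 // => k ki.
by rewrite mxE eq_sym (negbTE ki) scale0r.
Qed.

End InverseFunction.

(** A left inverse equals a right inverse: G = G o (F o G') = (G o F) o G' = G'. *)
Lemma compositional_inverse_unique (R : comNzRingType) n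
    (F G G' : 'I_n -> {fps R[n]}) : (forall i, F i 0%MM = 0) ->
  compositional_inverse F G -> compositional_inverse F G' -> G = G'.
Proof.
move=> F0 [G0 FG GF] [G'0 FG' GF']; apply: funext => i.
have <- : fps_comp (G i) (fun j => fps_comp (F j) G') = G i.
  by rewrite (_ : (fun _ => _) = fpsX) ?fps_comp_id //; apply: funext.
by rewrite -fps_compA // GF fps_compX.
Qed.

(** The system F' = A^-1 F is the identity up to order 2. If G' inverts it and L = A^-1 X, then G' o
    L inverts F = A F'. *)
Lemma compositional_inverse_exists (R : comUnitRingType) n
    (F H : 'I_n -> {fps R[n]}) (A : 'M[R]_n) : A \in unitmx ->
  (forall i, F i = \sum_(j < n) A i j *: fpsX j - H i) ->
  (forall i, order_ge 2 (H i)) ->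
  exists G, compositional_inverse F G.
Proof.
move=> Au FE H2; pose C := invmx A.
have F0 i : F i 0%MM = 0.
  rewrite FE fps_coefB H2 ?mdeg0 // subr0 fps_coef_sum big1 // => j _.
  by rewrite fps_coefZ fpsX_const mulr0.
pose L (i : 'I_n) : {fps R[n]} := \sum_(j < n) C i j *: fpsX j.
have L0 i : L i 0%MM = 0.
  by rewrite fps_coef_sum big1 // => j _; rewrite fps_coefZ fpsX_const mulr0.
have LcompE i (K : 'I_n -> {fps R[n]}) : (forall j, K j 0%MM = 0) ->
    forall B : 'M[R]_n,
    fps_comp (\sum_(j < n) B i j *: fpsX j) K = \sum_(j < n) B i j *: K j.
  move=> K0 B; rewrite fps_comp_sumr //; apply: eq_bigr => j _.
  by rewrite fps_compZ fps_compX.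
pose F' i := \sum_(j < n) C i j *: F j.
have F'0 i : F' i 0%MM = 0.
  by rewrite fps_coef_sum big1 // => j _; rewrite fps_coefZ F0 mulr0.
have F'X i : order_ge 2 (fpsX i - F' i).
  rewrite (_ : _ - _ = \sum_(j < n) C i j *: H j).
    by apply: supported_sum => j _; apply: supportedZ; exact: H2.
  rewrite /F' (eq_bigr (fun j =>
    C i j *: (\sum_(k < n) A j k *: fpsX k) - C i j *: H j)).
    by rewrite sumrB mx_comb_mul mulVmx // mx_comb1 opprB addrCA subrr addr0.
  by move=> j _; rewrite FE scalerBr.
have FF' i : F i = \sum_(j < n) A i j *: F' j.
  by rewrite mx_comb_mul mulmxV // mx_comb1.
have [G' [G'0 FG' GF']] := near_identity_inverse F'0 F'X.
exists (fun i => fps_comp (G' i) L); split=> i.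
- by rewrite fps_comp_const.
- rewrite -fps_compA // FF' fps_comp_sumr //.
  rewrite (eq_bigr (fun j => A i j *: fpsX j)); last first.
    by move=> j _; rewrite fps_compZ // FG'.
  by rewrite LcompE // mx_comb_mul mulmxV // mx_comb1.
rewrite fps_compA // (_ : (fun _ => _) = F') ?GF' //.
by apply: funext => j; rewrite LcompE.
Qed.

(** * Gaussian moments *)

(** The inverse map deletes i0 from the source and its image j0 from the target, and renumbers what
    remains. *)
Lemma lift_perm_bij_on k (i0 j0 : 'I_k.+1) :
  {on [pred s : 'S_k.+1 | s i0 == j0], bijective (lift_perm i0 j0)}.
Proof.
have low (s : 'S_k.+1) i : {j | lift (s i0) j = s (lift i0 i)}.
  case: (unliftP (s i0) (s (lift i0 i))) => [j ->|/perm_inj e].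
    by exists j.
  by have := neq_lift i0 i; rewrite e eqxx.
have low_inj s : injective (fun i => sval (low s i)).
  move=> i j e; apply: (@lift_inj _ i0); apply: (@perm_inj _ s).
  by rewrite -(svalP (low s i)) -(svalP (low s j)) e.
exists (fun s => perm (@low_inj s)) => [s _|s].
  apply/permP => i; rewrite permE; apply: (@lift_inj _ j0).
  rewrite -{1}(lift_perm_id i0 j0 s) -(lift_perm_lift i0 j0 s i).
  exact: svalP (low _ i).
rewrite inE => /eqP si0; apply/permP => i; case: (unliftP i0 i) => [j|] ->.
  by rewrite lift_perm_lift permE -si0; apply: svalP (low s j).
by rewrite lift_perm_id.
Qed.

(** Laplace expansion of a permanent along column j0: permutations are sorted by the index i0 that
    they send to j0. *)
Lemma permanent_expand (R : comNzRingType) k (M : 'I_k.+1 -> 'I_k.+1 -> R) j0 :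
  \sum_(s : 'S_k.+1) \prod_i M i (s i) =
  \sum_i0 M i0 j0 *
    \sum_(s : 'S_k) \prod_i M (lift i0 i) (lift j0 (s i)).
Proof.
rewrite (partition_big (fun s : 'S_k.+1 => (s^-1)%g j0) predT) //=.
apply: eq_bigr => i0 _.
rewrite (eq_bigl [pred s : 'S_k.+1 | s i0 == j0]); last first.
  by move=> s /=; rewrite -(inj_eq (@perm_inj _ s)) permKV eq_sym.
rewrite (reindex _ (lift_perm_bij_on i0 j0)) big_distrr /=.
apply: eq_big => [s|s _]; first by rewrite lift_perm_id eqxx.
rewrite (bigD1_ord i0) //= lift_perm_id; congr (_ * _).
by apply: eq_bigr => i _; rewrite lift_perm_lift.
Qed.

(** * Wick's recursion for the moments *)

Section Moments.
Variables (n : nat) (R : comUnitRingType) (A : 'M[R]_n).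

Lemma gauss_moment_of_neq k1 k2 (t1 : 'I_k1 -> 'I_n) (t2 : 'I_k2 -> 'I_n) :
  k1 != k2 -> gauss_moment_of A t1 t2 = 0.
Proof.
move=> ne; rewrite /gauss_moment_of big_pred0 ?mulr0 // => s.
apply/negbTE; apply: contra ne => /asboolP /bij_eq_card.
by rewrite !card_ord => ->.
Qed.

Lemma gauss_moment_of_perm k (t1 t2 : 'I_k -> 'I_n) :
  gauss_moment_of A t1 t2 =
  (\det A)^-1 * \sum_(s : 'S_k) \prod_i invmx A (t2 (s i)) (t1 i).
Proof.
rewrite /gauss_moment_of; congr (_ * _).
(* The identity permutation is only the default value of [insubd], never taken on a bijective
   function. *)
rewrite (reindex_onto (val : 'S_k -> {ffun 'I_k -> 'I_k})
  (insubd (1%g : 'S_k))) /= => [|f /asboolP bf].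
  apply: eq_big => [s|s _]; last by apply: eq_bigr => i _; rewrite pvalE.
  rewrite valKd eqxx andbT; apply/asboolP.
  by apply: eq_bij (injF_bij (@perm_inj _ s)) _ _ => i; rewrite pvalE.
by rewrite insubdK //; apply/injectiveP/bij_inj.
Qed.

Lemma gauss_moment_of_expand k1 k2
    (t1 : 'I_k1.+1 -> 'I_n) (t2 : 'I_k2.+1 -> 'I_n) :
  gauss_moment_of A t1 t2 =
  \sum_k invmx A (t2 ord0) (t1 k) *
    gauss_moment_of A (fun i => t1 (lift k i)) (fun i => t2 (lift ord0 i)).
Proof.
have [e|ne] := eqVneq k1 k2; last first.
  rewrite gauss_moment_of_neq // big1 // => k _.
  by rewrite gauss_moment_of_neq ?mulr0.
subst k2; rewrite gauss_moment_of_perm.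
rewrite (permanent_expand (fun i j => invmx A (t2 j) (t1 i)) ord0).
rewrite big_distrr /=; apply: eq_bigr => k _.
by rewrite gauss_moment_of_perm mulrCA.
Qed.

Lemma mdeg_count k (t : 'I_k -> 'I_n) (a : 'X_{1..n}) :
  (forall i, #|[set j | t j == i]| = a i) -> k = mdeg a.
Proof.
move=> ta; rewrite mdegE -[LHS]card_ord -sum1_card.
rewrite (partition_big t predT) //=; apply: eq_bigr => i _.
by rewrite -ta -sum1_card; apply: eq_bigl => j; rewrite inE.
Qed.

(** The lengths k1 and k2 are variables, so that enumerations obtained by adding or deleting an
    index fit without casts. *)
Lemma gauss_moment_ofE (a1 a2 : 'X_{1..n}) k1 k2
    (t1 : 'I_k1 -> 'I_n) (t2 : 'I_k2 -> 'I_n) :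
  (forall i, #|[set k | t1 k == i]| = a1 i) ->
  (forall i, #|[set k | t2 k == i]| = a2 i) ->
  gauss_moment_of A t1 t2 = gauss_moment A a1 a2.
Proof.
move=> h1 h2; have e1 := mdeg_count h1; have e2 := mdeg_count h2; subst k1 k2.
exact: gauss_moment_indep.
Qed.

Lemma gauss_moment_neq (a1 a2 : 'X_{1..n}) :
  mdeg a1 != mdeg a2 -> gauss_moment A a1 a2 = 0.
Proof. exact: gauss_moment_of_neq. Qed.

Lemma gauss_moment00 : gauss_moment A 0%MM 0%MM = (\det A)^-1.
Proof.
pose t (k : 'I_0) : 'I_n := match notF (ltn_ord k) with end.
have ht i : #|[set k | t k == i]| = 0%MM i.
  by rewrite mnm0E; apply: eq_card0 => -[].
rewrite -(gauss_moment_ofE ht ht) gauss_moment_of_perm.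
rewrite (bigD1 1%g) //= big_ord0 [X in _ + X]big1 => [|s].
  by rewrite addr0 mulr1.
by rewrite (_ : s = 1%g) ?eqxx //; apply/permP => -[].
Qed.

Lemma card_fiber k (t : 'I_k -> 'I_n) i :
  #|[set j | t j == i]| = (\sum_j (t j == i))%N.
Proof. by rewrite cardsE -sum1_card big_mkcond. Qed.

(** The new factor u_j is paired with each factor ubar in turn, and the a1 i factors equal to ubar_i
    contribute equally. Where the subtraction of U_(i) would be truncated, the multiplicity a1 i is
    0. *)
Lemma gauss_momentDr (a1 a2 : 'X_{1..n}) j :
  gauss_moment A a1 (a2 + U_(j))%MM =
  \sum_i invmx A j i * gauss_moment A (a1 - U_(i))%MM a2 *+ a1 i.
Proof.
(* The added index j is listed first, so that expansion at [ord0] isolates it. *)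
pose t2 (k : 'I_(mdeg a2).+1) :=
  if unlift ord0 k is Some k' then mnm_enum a2 k' else j.
have t20 : t2 ord0 = j by rewrite /t2 unlift_none.
have t2S k : t2 (lift ord0 k) = mnm_enum a2 k by rewrite /t2 liftK.
have h2 i : #|[set k | t2 k == i]| = (a2 + U_(j))%MM i.
  rewrite card_fiber big_ord_recl t20 mnmDE mnm1E addnC; congr addn.
  by rewrite -card_mnm_enum card_fiber; apply: eq_bigr => k _; rewrite t2S.
have [k1 [t1 h1]] : exists k1 (t1 : 'I_k1 -> 'I_n),
    forall i, #|[set k | t1 k == i]| = a1 i.
  by exists (mdeg a1), (mnm_enum a1); apply: card_mnm_enum.
rewrite -(gauss_moment_ofE h1 h2); case: k1 t1 h1 => [|k1] t1 h1.
  rewrite gauss_moment_of_neq // big1 // => i _.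
  by rewrite -h1 card_fiber big_ord0.
rewrite gauss_moment_of_expand t20.
rewrite (eq_bigr (fun k => invmx A j (t1 k) *
  gauss_moment A (a1 - U_(t1 k))%MM a2)) => [|k _]; last first.
  congr (_ * _); apply: gauss_moment_ofE => i.
    rewrite mnmBE mnm1E -h1 !card_fiber.
    by rewrite [in RHS](bigD1_ord k) //= addKn.
  by rewrite -card_mnm_enum !card_fiber; apply: eq_bigr => l _; rewrite t2S.
rewrite (partition_big t1 predT) //=; apply: eq_bigr => i _.
rewrite -h1 -sumr_const big_mkcond [RHS]big_mkcond.
by apply: eq_bigr => k _; rewrite inE; case: eqP => // ->.
Qed.

End Moments.

(** * Derivations and exponentials *)

Section Derivation.
Variables (n : nat) (R : comNzRingType) (i : 'I_n).
Implicit Types f g : {fps R[n]}.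

Lemma fps_deriv_cong d f g :
  fps_cong d.+1 f g -> fps_cong d (fps_deriv i f) (fps_deriv i g).
Proof. by move=> fg m md /=; rewrite fg // mdegD mdeg1 addn1. Qed.

Lemma fps_derivD f g : fps_deriv i (f + g) = fps_deriv i f + fps_deriv i g.
Proof. by apply/fpsP => m /=; rewrite mulrnDl. Qed.

Lemma fps_derivZ c f : fps_deriv i (c *: f) = c *: fps_deriv i f.
Proof. by apply/fpsP => m /=; rewrite mulrnAr. Qed.

Lemma fps_deriv_sum (I : Type) (r : seq I) (P : pred I) (F : I -> {fps R[n]}) :
  fps_deriv i (\sum_(j <- r | P j) F j) = \sum_(j <- r | P j) fps_deriv i (F j).
Proof.
apply: (big_morph (fps_deriv i)); first exact: fps_derivD.
by apply/fpsP => m /=; rewrite mul0rn.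
Qed.

Lemma fps_derivM f g :
  fps_deriv i (f * g) = fps_deriv i f * g + f * fps_deriv i g.
Proof.
(* Differentiation lowers degrees by one, so the coefficient at m depends on degrees up to |m| +
   1. *)
apply/fpsP => m; set d := (mdeg m).+2.
have deriv_trunc (h : {fps R[n]}) k : (mdeg k < (mdeg m).+1)%N ->
    (fps_trunc (mdeg m).+1 (fps_deriv i h))@_k = ((fps_trunc d h)^`M(i))@_k.
  move=> kd; have kd' : (mdeg (k + U_(i)) < d)%N by rewrite mdegD mdeg1 addn1.
  by rewrite mcoeff_deriv !coef_trunc kd kd'.
have trunc_trunc (h : {fps R[n]}) k : (mdeg k < (mdeg m).+1)%N ->
    (fps_trunc (mdeg m).+1 h)@_k = (fps_trunc d h)@_k.
  by move=> kd; rewrite !coef_trunc kd (ltn_trans kd).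
have -> : fps_deriv i (f * g) m = (fps_trunc d f * fps_trunc d g)^`M(i)@_m.
  rewrite mcoeff_deriv /=; congr (_ *+ _); apply: coefM_trunc.
  by rewrite mdegD mdeg1 addn1.
rewrite mderivM mcoeffD fps_coefD; congr (_ + _); apply/esym.
  have /coefM_trunc -> : (mdeg m < (mdeg m).+1)%N by [].
  by apply: fps_trunc_eq (deriv_trunc f) (trunc_trunc g) _.
have /coefM_trunc -> : (mdeg m < (mdeg m).+1)%N by [].
by apply: fps_trunc_eq (trunc_trunc f) (deriv_trunc g) _.
Qed.

Lemma fps_deriv_supported f : supported (fun m => m i == 0%N) f ->
  fps_deriv i f = 0.
Proof.
move=> f0; apply/fpsP => m /=; rewrite f0 ?mul0rn //.
by rewrite mnmDE mnm1E eqxx addn1.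
Qed.

Lemma fps_deriv1 : fps_deriv i (1 : {fps R[n]}) = 0.
Proof. by apply/fps_deriv_supported/supported1; rewrite mnm0E. Qed.

Lemma fps_derivX j : fps_deriv i (fpsX j) = (i == j)%:R :> {fps R[n]}.
Proof.
have [<-|ne] := eqVneq i j; last first.
  apply/fps_deriv_supported/supportedX.
  by rewrite mnm1E [j == i]eq_sym (negbTE ne).
apply/fpsP => m /=; rewrite -[X in _ == X]add0m eqm_add2r.
by case: eqP => [->|_]; rewrite ?mnm0E ?mul0rn // mulr1n.
Qed.

Lemma fps_deriv_expr f k :
  fps_deriv i (f ^+ k.+1) = k.+1%:R *: (fps_deriv i f * f ^+ k).
Proof.
elim: k => [|k IH]; first by rewrite expr1 expr0 mulr1 scale1r.
rewrite exprS fps_derivM IH -scalerAr mulrCA -exprS -[in RHS]natr1.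
by rewrite scalerDl scale1r addrC.
Qed.

End Derivation.

(** * The exponential series and its derivative *)

Section Exponential.
Variables (n : nat) (R : comUnitRingType).
Implicit Types f : {fps R[n]}.

Lemma fps_exp_sum f d : f 0%MM = 0 ->
  fps_cong d (fps_exp f) (\sum_(k < d) (k`!%:R)^-1 *: f ^+ k).
Proof.
move=> f0 m md; rewrite fps_coef_sum.
rewrite [LHS](big_ord_widen d (fun k => (k`!%:R)^-1 * (f ^+ k) m)) //=.
rewrite big_mkcond; apply: eq_bigr => k _; case: ifP => // /negbT.
rewrite -leqNgt => mk; rewrite (_ : (f ^+ k) m = 0) ?mulr0 //.
have := order_ge_expr (k := k) (order_ge_const f0); rewrite muln1.
by apply; rewrite -ltnNge.
Qed.

Lemma fps_exp_const f : fps_exp f 0%MM = 1.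
Proof. by rewrite /= mdeg0 big_ord1 fact0 invr1 mul1r expr0 fps_coef1 eqxx. Qed.

Lemma supported_fps_exp (Q : pred 'X_{1..n}) f :
  Q 0%MM -> (forall a b, Q a -> Q b -> Q (a + b)%MM) ->
  supported Q f -> supported Q (fps_exp f).
Proof.
move=> Q0 QD fQ m nQ; rewrite /= big1 // => k _.
by rewrite (supported_expr Q0 QD k fQ nQ) mulr0.
Qed.

(** Termwise differentiation of the partial sums: the term k = 0 disappears, and in the others k + 1
    cancels against (k + 1)!, the positive integers being units. *)
Lemma fps_deriv_exp i f : (forall k, (k.+1%:R : R) \is a GRing.unit) ->
  f 0%MM = 0 -> fps_deriv i (fps_exp f) = fps_deriv i f * fps_exp f.
Proof.
move=> natU f0; apply: fps_congP => d.
(* The partial sum is taken modulo degree d + 1 because differentiation loses one degree. *)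
apply: fps_cong_trans (fps_deriv_cong i (fps_exp_sum (d := d.+1) f0)) _.
have h : fps_cong d (fps_deriv i f) (fps_deriv i f) by [].
apply: fps_cong_trans (fps_cong_sym (fps_congM h (fps_exp_sum (d := d) f0))).
rewrite fps_deriv_sum big_ord_recl expr0 fps_derivZ fps_deriv1 scaler0 add0r.
rewrite mulr_sumr (eq_bigr (fun k : 'I_d => (k`!%:R)^-1 *:
  (fps_deriv i f * f ^+ k))); last first.
  move=> k _; rewrite fps_derivZ /= fps_deriv_expr scalerA factS natrM.
  rewrite invrM ?mulrVK //; elim: (k : nat) => [|l IH]; rewrite ?unitr1 //.
  by rewrite factS natrM unitrM natU.
by under [X in fps_cong _ _ X]eq_bigr do rewrite -scalerAr.
Qed.

End Exponential.

(** * Gaussian integrals *)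

Section Blocks.
Variable n : nat.
Implicit Types (a b : 'X_{1..n}) (m : 'X_{1..n + (n + n)}).

Lemma mnm3_ubar a1 a2 a3 i : mnm3 a1 a2 a3 (lshift (n + n) i) = a1 i.
Proof. exact: tnth_lshift. Qed.

Lemma mnm3_u a1 a2 a3 i : mnm3 a1 a2 a3 (rshift n (lshift n i)) = a2 i.
Proof. by rewrite /mnm3 /fun_of_multinom /= tnth_rshift tnth_lshift. Qed.

Lemma mnm3_Y a1 a2 a3 i : mnm3 a1 a2 a3 (rshift n (rshift n i)) = a3 i.
Proof. by rewrite /mnm3 /fun_of_multinom /= !tnth_rshift. Qed.

Definition mnm3E := (mnm3_ubar, mnm3_u, mnm3_Y).

Lemma mnm3P m m' :
  (forall i, m (lshift (n + n) i) = m' (lshift (n + n) i)) ->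
  (forall i, m (rshift n (lshift n i)) = m' (rshift n (lshift n i))) ->
  (forall i, m (rshift n (rshift n i)) = m' (rshift n (rshift n i))) ->
  m = m'.
Proof.
move=> h1 h2 h3; apply/mnmP => i; case: (split_ordP i) => [j -> //|k ->].
by case: (split_ordP k) => [j ->|j ->].
Qed.

Lemma mnm3_Dubar a1 a2 a3 i :
  mnm3 (a1 + U_(i)) a2 a3 = (mnm3 a1 a2 a3 + U_(lshift (n + n) i))%MM.
Proof.
by apply: mnm3P => j; rewrite !(mnmDE, mnm3E, mnm1E, eq_shift) ?addn0.
Qed.

Lemma mnm3_Bu a1 a2 a3 i :
  mnm3 a1 (a2 - U_(i)) a3 = (mnm3 a1 a2 a3 - U_(rshift n (lshift n i)))%MM.
Proof.
by apply: mnm3P => j; rewrite !(mnmBE, mnm3E, mnm1E, eq_shift) ?subn0.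
Qed.

Lemma mnm3_BY a1 a2 a3 i :
  mnm3 a1 a2 (a3 - U_(i)) = (mnm3 a1 a2 a3 - U_(rshift n (rshift n i)))%MM.
Proof.
by apply: mnm3P => j; rewrite !(mnmBE, mnm3E, mnm1E, eq_shift) ?subn0.
Qed.

Lemma mnm3_0 : mnm3 0 0 0 = 0%MM :> 'X_{1..n + (n + n)}.
Proof. by apply: mnm3P => j; rewrite mnm3E !mnm0E. Qed.

Definition deg_ubar m := (\sum_(i < n) m (lshift (n + n) i))%N.
Definition deg_u m := (\sum_(i < n) m (rshift n (lshift n i)))%N.
Definition deg_Y m := (\sum_(i < n) m (rshift n (rshift n i)))%N.

Lemma mdeg_blocks m : mdeg m = (deg_ubar m + deg_u m + deg_Y m)%N.
Proof. by rewrite mdegE !big_split_ord /= addnA. Qed.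

Lemma deg_ubarD m m' : deg_ubar (m + m')%MM = (deg_ubar m + deg_ubar m')%N.
Proof. by rewrite -big_split; apply: eq_bigr => i _; rewrite mnmDE. Qed.

Lemma deg_uD m m' : deg_u (m + m')%MM = (deg_u m + deg_u m')%N.
Proof. by rewrite -big_split; apply: eq_bigr => i _; rewrite mnmDE. Qed.

Lemma deg_YD m m' : deg_Y (m + m')%MM = (deg_Y m + deg_Y m')%N.
Proof. by rewrite -big_split; apply: eq_bigr => i _; rewrite mnmDE. Qed.

Lemma deg_mnm3 a1 a2 a3 : [/\ deg_ubar (mnm3 a1 a2 a3) = mdeg a1,
  deg_u (mnm3 a1 a2 a3) = mdeg a2 & deg_Y (mnm3 a1 a2 a3) = mdeg a3].
Proof. by rewrite !mdegE; split; apply: eq_bigr => i _; rewrite mnm3E. Qed.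

Lemma mnm1_mnm3 i : [/\ U_(lshift (n + n) i)%MM = mnm3 U_(i) 0 0,
  U_(rshift n (lshift n i))%MM = mnm3 0 U_(i) 0 &
  U_(rshift n (rshift n i))%MM = mnm3 0 0 U_(i)].
Proof.
by split; apply: mnm3P => j; rewrite !(mnm3E, mnm1E, mnm0E, eq_shift).
Qed.

(* The exponents for which a monomial ubar^a1 u^a2 Y^a3 of fixed a3 can have a
   nonzero moment, hence |a1| = |a2|, are then bounded: |a1| <= 2 |a3|. *)
Definition balanced m := (2 * deg_ubar m <= deg_u m + 2 * deg_Y m)%N.

Definition u_only m := (deg_ubar m == 0)%N && (deg_Y m == 0)%N.

Lemma balanced_mnm3 a1 a2 a3 :
  balanced (mnm3 a1 a2 a3) = (2 * mdeg a1 <= mdeg a2 + 2 * mdeg a3)%N.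
Proof. by rewrite /balanced; have [-> -> ->] := deg_mnm3 a1 a2 a3. Qed.

Lemma balanced0 : balanced 0.
Proof. by rewrite -mnm3_0 balanced_mnm3 mdeg0. Qed.

Lemma balancedD m m' : balanced m -> balanced m' -> balanced (m + m')%MM.
Proof. rewrite /balanced deg_ubarD deg_uD deg_YD; lia. Qed.

Lemma u_only0 : u_only 0.
Proof.
rewrite /u_only -mnm3_0; have [-> _ ->] := deg_mnm3 0%MM 0%MM 0%MM.
by rewrite mdeg0.
Qed.

Lemma u_onlyD m m' : u_only m -> u_only m' -> u_only (m + m')%MM.
Proof. rewrite /u_only deg_ubarD deg_YD; lia. Qed.

Lemma u_only_balanced m : u_only m -> balanced m.
Proof. by rewrite /u_only /balanced => /andP[/eqP -> _]. Qed.

End Blocks.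

Arguments balanced {n} m.
Arguments u_only {n} m.

(** * Integrals of balanced series, and integration by parts *)

Section GaussianIntegral.
Variables (n : nat) (R : comUnitRingType) (A : 'M[R]_n).
Implicit Types (U V : {fps R[n + (n + n)]}) (a : 'X_{1..n} * 'X_{1..n}).

(** A finite set of exponents outside which the terms vanish; it turns finitely supported sums into
    ordinary finite sums. *)
Definition box N : set ('X_{1..n} * 'X_{1..n}) :=
  [set a | (mdeg a.1 < N)%N /\ (mdeg a.2 < N)%N]%classic.

Lemma box_finite N : finite_set (box N).
Proof.
have fin : finite_set [set b : 'X_{1..n} | (mdeg b < N)%N]%classic.
  apply: (@sub_finite_set _ _ ((@bmnm n N) @` setT)%classic).
    by move=> b /= bN; exists (BMultinom bN).
  exact/finite_image/finite_finset.
apply: sub_finite_set (finite_setX fin fin).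
by move=> [b c].
Qed.

Lemma fsum_box N (f : 'X_{1..n} * 'X_{1..n} -> R) :
  (forall a, f a != 0 -> box N a) ->
  \sum_(a \in [set: _]%classic) f a = \sum_(a <- fset_set (box N)) f a.
Proof.
move=> fN; rewrite -(fsbig_finite _ _ (box_finite N)).
apply/esym/fsbig_widen => // a [_ na] /=.
by apply: contra_notP na => /eqP; apply: fN.
Qed.

Lemma fsum_shift (h : 'X_{1..n} * 'X_{1..n} -> 'X_{1..n} * 'X_{1..n})
    (f : 'X_{1..n} * 'X_{1..n} -> R) : injective h ->
  (forall a, f a != 0 -> exists b, h b = a) ->
  \sum_(a \in [set: _]%classic) f a = \sum_(a \in [set: _]%classic) f (h a).
Proof.
move=> h_inj fh; rewrite -(fsbig_image setT h); last by move=> x y _ _ /h_inj.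
apply/esym/fsbig_widen => // a [_ na] /=.
apply: contra_notP na => /eqP /fh [b <-]; exact: imageP.
Qed.

Lemma gauss_term_box U (a3 : 'X_{1..n}) N a :
  supported balanced U -> (2 * mdeg a3 < N)%N ->
  gauss_term A U a3 a != 0 -> box N a.
Proof.
rewrite /gauss_term => Ub a3N.
have [bal|/Ub ->] := boolP (balanced (mnm3 a.1 a.2 a3)).
  have [e _|ne] := eqVneq (mdeg a.1) (mdeg a.2); last first.
    by rewrite gauss_moment_neq ?mulr0 ?eqxx.
  by move: bal; rewrite balanced_mnm3 /box /=; split; lia.
by rewrite mul0r eqxx.
Qed.

Lemma balanced_integrable U : supported balanced U -> gauss_integrable A U.
Proof.
move=> Ub a3; apply: sub_finite_set (box_finite (2 * mdeg a3).+1) => a /=.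
exact: gauss_term_box.
Qed.

Lemma gauss_integral_box U (a3 : 'X_{1..n}) : supported balanced U ->
  gauss_integral A U a3 =
  \sum_(a <- fset_set (box (2 * mdeg a3).+1)) gauss_term A U a3 a.
Proof. by move=> Ub; apply: fsum_box => a; apply: gauss_term_box. Qed.

Lemma gauss_integralD U V : supported balanced U -> supported balanced V ->
  gauss_integral A (U + V) = gauss_integral A U + gauss_integral A V.
Proof.
move=> Ub Vb; apply/fpsP => a3; rewrite fps_coefD !gauss_integral_box //.
  by rewrite -big_split; apply: eq_bigr => a _; rewrite /gauss_term mulrDl.
exact: supportedD.
Qed.

Lemma gauss_integralZ c U : supported balanced U ->
  gauss_integral A (c *: U) = c *: gauss_integral A U.
Proof.
move=> Ub; apply/fpsP => a3; rewrite fps_coefZ !gauss_integral_box //.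
  rewrite mulr_sumr; apply: eq_bigr => a _.
  by rewrite /gauss_term fps_coefZ -mulrA.
exact: supportedZ.
Qed.

Lemma gauss_integral_sum (I : Type) (r : seq I) (P : pred I) F :
  (forall i, P i -> supported balanced (F i)) ->
  gauss_integral A (\sum_(i <- r | P i) F i) =
  \sum_(i <- r | P i) gauss_integral A (F i).
Proof.
move=> Fb.
suff [] : supported balanced (\sum_(i <- r | P i) F i) /\
  gauss_integral A (\sum_(i <- r | P i) F i) =
  \sum_(i <- r | P i) gauss_integral A (F i) by [].
elim/big_rec2: _ => [|i u V Pi [Vb <-]].
  split=> //; apply/fpsP => a3; rewrite gauss_integral_box //.
  by rewrite big1 // => a _; rewrite /gauss_term mul0r.
split; first exact: supportedD (Fb i Pi) Vb.
by rewrite gauss_integralD //; apply: Fb.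
Qed.

Lemma gauss_integralB U V : supported balanced U -> supported balanced V ->
  gauss_integral A (U - V) = gauss_integral A U - gauss_integral A V.
Proof.
move=> Ub Vb; rewrite -scaleN1r gauss_integralD //; last exact: supportedZ.
by rewrite gauss_integralZ // scaleN1r.
Qed.

(** A contributing monomial has |a1| = |a2| <= 2 |a3|, hence total degree at most 5 |a3|; this is
    the origin of the factor 5. *)
Lemma order_ge_gauss_integral d U : supported balanced U ->
  order_ge (5 * d) U -> order_ge d (gauss_integral A U).
Proof.
move=> Ub Ud a3; rewrite -ltnNge => a3d; rewrite /= fsbig1 // => a _.
rewrite /gauss_term; have [e|ne] := eqVneq (mdeg a.1) (mdeg a.2); last first.
  by rewrite gauss_moment_neq ?mulr0.
have [|/Ub ->] := boolP (balanced (mnm3 a.1 a.2 a3)); last by rewrite mul0r.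
rewrite balanced_mnm3 => bal; rewrite Ud ?mul0r // -ltnNge mdeg_blocks.
by have [-> -> ->] := deg_mnm3 a.1 a.2 a3; lia.
Qed.

Lemma gauss_integral_Yvar U j :
  gauss_integral A (Yvar j * U) = fpsX j * gauss_integral A U.
Proof.
apply/fpsP => a3; rewrite fps_coefXM /=; case: ltnP => a3j.
  apply: eq_fsbigr => a _; rewrite /gauss_term fps_coefXM mnm3E a3j.
  by rewrite -mnm3_BY.
rewrite fsbig1 // => a _; rewrite /gauss_term fps_coefXM mnm3E ltnNge a3j.
by rewrite mul0r.
Qed.

Lemma supported_deriv_ubar U i : supported balanced U ->
  supported balanced (fps_deriv (lshift (n + n) i) U).
Proof.
move=> Ub m nb /=; rewrite Ub ?mul0rn //; apply: contra nb.
have [-> _ _] := mnm1_mnm3 i; have [d1 d2 d3] := deg_mnm3 U_(i)%MM 0%MM 0%MM.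
by rewrite /balanced deg_ubarD deg_uD deg_YD d1 d2 d3 mdeg1 mdeg0; lia.
Qed.

(** Integration by parts: a shift of a2 absorbs u_j, the recursion for the moments removes one
    factor ubar_i, and a shift of a1 turns the result into a derivative. *)
Lemma gauss_integral_uvar U j : supported balanced U ->
  gauss_integral A (uvar j * U) =
  \sum_i invmx A j i *: gauss_integral A (fps_deriv (lshift (n + n) i) U).
Proof.
move=> Ub; apply/fpsP => a3; rewrite fps_coef_sum /=.
pose h a := (a.1, (a.2 + U_(j))%MM).
rewrite (@fsum_shift h); first last.
- move=> a; rewrite /gauss_term fps_coefXM mnm3E.
  case: ltnP => [a2j _|_]; last by rewrite mul0r eqxx.
  exists (a.1, (a.2 - U_(j))%MM); rewrite /h /= submK; first by case: a {a2j}.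
  by rewrite lep1mP -lt0n.
- move=> [b c] [b' c'] e; move: (congr1 fst e) (congr1 snd e) => /= ->.
  by move/(can_inj (addmK _)) ->.
pose t i a := U (mnm3 a.1 a.2 a3) *
  (invmx A j i * gauss_moment A (a.1 - U_(i))%MM a.2 *+ a.1 i).
rewrite (eq_fsbigr (fun a => \sum_i t i a)); last first.
  move=> a _; rewrite /gauss_term fps_coefXM mnm3E mnmDE mnm1E eqxx addn1 /=.
  by rewrite -mnm3_Bu addmK gauss_momentDr mulr_sumr.
(* A nonzero term has |a1| = |a2| + 1, which together with balance bounds both degrees, so the two
   sums can be exchanged. *)
have tN i a : t i a != 0 -> box (2 * mdeg a3).+2 a.
  rewrite /t; have [bal|/Ub ->] := boolP (balanced (mnm3 a.1 a.2 a3));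
    last by rewrite mul0r eqxx.
  have [->|a1i] := posnP (a.1 i); first by rewrite mulr0n mulr0 eqxx.
  have [e _|ne] := eqVneq (mdeg (a.1 - U_(i))%MM) (mdeg a.2); last first.
    by rewrite gauss_moment_neq // mulr0 mul0rn mulr0 eqxx.
  move: bal; rewrite balanced_mnm3.
  have e1 : mdeg a.1 = (mdeg a.2).+1.
    by rewrite -e -addn1 -(mdeg1 i) -mdegD submK // lep1mP -lt0n.
  by rewrite /box /=; split; lia.
rewrite (@fsum_box (2 * mdeg a3).+2); last first.
  move=> a; apply: contra_neqP => na; rewrite big1 // => i _.
  by apply: contra_notP na => /eqP; apply: tN.
rewrite exchange_big; apply: eq_bigr => i _.
rewrite -(fsum_box (tN i)).
(* After this shift the multiplicity a1 i becomes the factor produced by differentiating in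
   ubar_i. *)
pose g a := ((a.1 + U_(i))%MM, a.2).
rewrite (@fsum_shift g); first last.
- move=> a; rewrite /t; have [->|a1i _] := posnP (a.1 i).
    by rewrite mulr0n mulr0 eqxx.
  exists ((a.1 - U_(i))%MM, a.2); rewrite /g /= submK; first by case: a {a1i}.
  by rewrite lep1mP -lt0n.
- move=> [b c] [b' c'] e; move: (congr1 snd e) (congr1 fst e) => /= ->.
  by move/(can_inj (addmK _)) ->.
rewrite -[RHS]/((_ *: gauss_integral A _) a3) -gauss_integralZ; last first.
  exact: supported_deriv_ubar.
apply: eq_fsbigr => a _; rewrite /t /gauss_term fps_coefZ /= mnm3_Dubar.
by rewrite mnm3E addmK mnmDE mnm1E eqxx addn1 !(mulrnAr, mulrnAl) mulrCA mulrA.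
Qed.

(** For a3 = 0, balance and |a1| = |a2| leave only a1 = a2 = 0. *)
Lemma gauss_integral_const U : supported balanced U ->
  gauss_integral A U 0%MM = U 0%MM * (\det A)^-1.
Proof.
move=> Ub; rewrite /= -(fsbig_widen [set (0%MM, 0%MM)]%classic) //.
  by rewrite fsbig_set1 /gauss_term /= mnm3_0 gauss_moment00.
move=> a [_ na] /=; apply: contra_notP na => /eqP /(gauss_term_box Ub) h.
have [] := h 1%N; first by rewrite mdeg0.
by rewrite !ltnS !leqn0 !mdeg_eq0; case: a {h} => b c /= /eqP -> /eqP ->.
Qed.

End GaussianIntegral.

(** * The integral against the weight, as a functional of P(u) *)

Section Expectation.
Variables (n : nat) (R : comUnitRingType) (F H : 'I_n -> {fps R[n]}).
Variable A : 'M[R]_n.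
Hypothesis H_ge2 : forall i, order_ge 2 (H i).

Implicit Types P Q : {fps R[n]}.

Local Notation at_u f := (fps_comp f uvar).

Definition exponent : {fps R[n + (n + n)]} :=
  \sum_(i < n) ubar i * at_u (H i) + \sum_(i < n) ubar i * Yvar i.

Definition weight := fps_exp exponent.

(** Not normalised: E(1) is the denominator of the inversion formula and E(X_i) its numerator. *)
Definition expectation (P : {fps R[n]}) : {fps R[n]} :=
  gauss_integral A (at_u P * weight).

Local Notation E := expectation.

Lemma uvar_const (i : 'I_n) : uvar i 0%MM = 0 :> R.
Proof. exact: fpsX_const. Qed.

Lemma u_only_at_u P : supported (@u_only n) (at_u P).
Proof.
refine (supported_comp (@u_only0 n) (@u_onlyD n) P _) => i.
have [_ eu _] := mnm1_mnm3 i; apply: supportedX; rewrite eu /u_only.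
by have [-> _ ->] := deg_mnm3 0%MM U_(i)%MM 0%MM; rewrite mdeg0.
Qed.

Lemma balanced_at_u P : supported balanced (at_u P).
Proof. exact: supportedW (@u_only_balanced n) (u_only_at_u P). Qed.

Lemma balanced_Yvar i : supported balanced (Yvar i : {fps R[n + (n + n)]}).
Proof.
by apply: supportedX; have [_ _ ->] := mnm1_mnm3 i;
  rewrite balanced_mnm3 mdeg0 mdeg1.
Qed.

Lemma balancedM (f g : {fps R[n + (n + n)]}) :
  supported balanced f -> supported balanced g -> supported balanced (f * g).
Proof. exact/supportedM/balancedD. Qed.

Lemma deg_U_ubar (i : 'I_n) : [/\ deg_ubar U_(lshift (n + n) i)%MM = 1%N,
  deg_u U_(lshift (n + n) i)%MM = 0%N & deg_Y U_(lshift (n + n) i)%MM = 0%N].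
Proof.
have [-> _ _] := mnm1_mnm3 i.
by have [-> -> ->] := deg_mnm3 U_(i)%MM 0%MM 0%MM; rewrite mdeg1 mdeg0.
Qed.

(** Each factor ubar_i is compensated either by the at least two factors u in every monomial of
    H_i(u), or by Y_i. The condition that H_i has order at least 2 enters here. *)
Lemma balanced_exponent : supported balanced exponent.
Proof.
apply: supportedD; apply: supported_sum => i _.
  apply: (@supportedM _ _ (pred1 U_(lshift (n + n) i)%MM)
    (fun m => u_only m && (2 <= mdeg m)%N)).
  - move=> a b /eqP -> /andP[/andP[/eqP b1 /eqP b3]]; rewrite mdeg_blocks b1 b3.
    have [u1 u2 u3] := deg_U_ubar i.
    by rewrite /balanced deg_ubarD deg_uD deg_YD u1 u2 u3 b1 b3; lia.
  - exact/supportedX/eqxx.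
  - move=> m; rewrite negb_and => /orP[/u_only_at_u //|].
    exact: (order_ge_comp (@uvar n R) (H_ge2 i)).
apply: (@supportedM _ _ (pred1 U_(lshift (n + n) i)%MM)
  (pred1 U_(rshift n (rshift n i))%MM)); try exact/supportedX/eqxx.
move=> a b /eqP -> /eqP ->; have [eu _ eY] := mnm1_mnm3 i.
rewrite /balanced deg_ubarD deg_uD deg_YD.
have [-> -> ->] := deg_U_ubar i; rewrite eY.
by have [-> -> ->] := deg_mnm3 0%MM 0%MM U_(i)%MM; rewrite mdeg1 mdeg0.
Qed.

Lemma balanced_weight : supported balanced weight.
Proof.
exact: supported_fps_exp (@balanced0 n) (@balancedD n) balanced_exponent.
Qed.

Lemma exponent_const : exponent 0%MM = 0.
Proof.
rewrite fps_coefD !fps_coef_sum !big1 ?addr0 // => i _;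
  by rewrite fps_coefM0 fpsX_const mul0r.
Qed.

Lemma fps_deriv_at_u i P : fps_deriv (lshift (n + n) i) (at_u P) = 0.
Proof.
apply: fps_deriv_supported; apply: supportedW (u_only_at_u P) => m.
by case/andP; rewrite sum_nat_eq0 => /forallP /(_ i).
Qed.

Hypothesis natU : forall k, (k.+1%:R : R) \is a GRing.unit.

Lemma fps_deriv_weight i :
  fps_deriv (lshift (n + n) i) weight = (at_u (H i) + Yvar i) * weight.
Proof.
rewrite fps_deriv_exp ?exponent_const //; congr (_ * _).
rewrite fps_derivD !fps_deriv_sum.
have ub j (g : {fps R[n + (n + n)]}) : fps_deriv (lshift (n + n) i) g = 0 ->
    fps_deriv (lshift (n + n) i) (ubar j * g) = (i == j)%:R * g.
  by move=> g0; rewrite fps_derivM g0 mulr0 addr0 fps_derivX eq_lshift.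
congr (_ + _).
  rewrite (bigD1 i) //= ub ?fps_deriv_at_u // eqxx mul1r big1 ?addr0 // => j ji.
  by rewrite ub ?fps_deriv_at_u // eq_sym (negbTE ji) mul0r.
have Y0 j : fps_deriv (lshift (n + n) i) (Yvar j) = 0 :> {fps R[n + (n + n)]}.
  by rewrite fps_derivX eq_lrshift.
rewrite (bigD1 i) //= ub // eqxx mul1r big1 ?addr0 // => j ji.
by rewrite ub // eq_sym (negbTE ji) mul0r.
Qed.

Lemma balanced_integrand P : supported balanced (at_u P * weight).
Proof. exact: balancedM (balanced_at_u P) balanced_weight. Qed.

Lemma expectationB P Q : E (P - Q) = E P - E Q.
Proof.
rewrite /E fps_compB mulrBl gauss_integralB //; exact: balanced_integrand.
Qed.

Lemma expectationZ c P : E (c *: P) = c *: E P.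
Proof.
rewrite /E fps_compZ -scalerAl gauss_integralZ //; exact: balanced_integrand.
Qed.

Lemma expectation_sum (I : Type) (r : seq I) (f : I -> {fps R[n]}) :
  E (\sum_(i <- r) f i) = \sum_(i <- r) E (f i).
Proof.
rewrite /E fps_comp_sumr mulr_suml gauss_integral_sum // => i _.
exact: balanced_integrand.
Qed.

Hypothesis A_unit : A \in unitmx.

Lemma expectation1_unit : E 1 \is a GRing.unit.
Proof.
apply: fps_unit_const; rewrite /E fps_comp1 ?mul1r; last exact: uvar_const.
rewrite gauss_integral_const; last exact: balanced_weight.
by rewrite fps_exp_const mul1r unitrV -unitmxE.
Qed.

Hypothesis F_def : forall i, F i = \sum_(j < n) A i j *: fpsX j - H i.
Hypothesis F0 : forall i, F i 0%MM = 0.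

(* Schwinger-Dyson equation: (A u)_i P(u) W and its counterpart
   d/dubar_i (P(u) W) = P(u) (H_i(u) + Y_i) W have the same integral. *)
Lemma expectation_mulF i P : E (F i * P) = fpsX i * E P.
Proof.
have u0 := uvar_const; set p := at_u P.
have pb := balanced_integrand P; rewrite -/p in pb.
have hb : supported balanced (at_u (H i) * (p * weight)).
  exact: balancedM (balanced_at_u _) pb.
have yb : supported balanced (Yvar i * (p * weight)).
  exact: balancedM (balanced_Yvar _) pb.
have ub j : supported balanced (uvar j * (p * weight)).
  by apply: balancedM pb; rewrite -(fps_compX u0); apply: balanced_at_u.
have Fp : at_u (F i * P) * weight =
    \sum_(j < n) A i j *: (uvar j * (p * weight)) - at_u (H i) * (p * weight).
  rewrite fps_compM // F_def fps_compB // fps_comp_sumr // -mulrA mulrBl.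
  rewrite mulr_suml; congr (_ - _); apply: eq_bigr => j _.
  by rewrite fps_compZ fps_compX // -scalerAl.
rewrite /E Fp gauss_integralB //; last first.
  by apply: supported_sum => j _; apply: supportedZ.
rewrite gauss_integral_sum => [|j _]; last exact: supportedZ.
under eq_bigr do rewrite gauss_integralZ // gauss_integral_uvar //.
(* A A^-1 = 1 leaves the single derivative in ubar_i, which acts on the weight alone; its H_i part
   then cancels the subtracted integral. *)
rewrite mx_comb_mul mulmxV // mx_comb1 fps_derivM fps_deriv_at_u mul0r add0r.
rewrite fps_deriv_weight mulrCA mulrDl gauss_integralD // gauss_integral_Yvar.
by rewrite addrAC subrr add0r.
Qed.

Lemma expectation_monomial a : E (mmap1 F a) = mmap1 fpsX a * E 1.
Proof.
(* The arbitrary factor P allows the factors F_i to be pulled out one at a time. *)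
suff h P : E (mmap1 F a * P) = mmap1 fpsX a * E P.
  by rewrite -{1}[mmap1 F a]mulr1.
rewrite /mmap1; elim/big_ind2: _ P => [P|f f' g g' ef eg P|i _ P].
- by rewrite !mul1r.
- by rewrite -!mulrA ef eg.
elim: (a i) P => [|k IH] P; first by rewrite !mul1r.
by rewrite !exprS -!mulrA expectation_mulF IH.
Qed.

(** Continuity of E, by which the identity for monomials extends to power series. *)
Lemma expectation_cong d P Q : fps_cong (5 * d) P Q -> fps_cong d (E P) (E Q).
Proof.
move=> PQ; apply: fps_cong_sub; rewrite -expectationB.
apply: order_ge_gauss_integral; first exact: balanced_integrand.
by apply/order_geMr/order_ge_comp/order_ge_sub.
Qed.

Lemma expectation_comp g : E (fps_comp g F) = g * E 1.
Proof.
apply: fps_congP => d; have X0 := @fpsX_const R n.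
(* The series g is cut at degree 5 d to control its expectation below degree d. *)
apply: fps_cong_trans (expectation_cong (fps_comp_sum F0 (d := 5 * d) g)) _.
rewrite expectation_sum.
under eq_bigr do rewrite expectationZ expectation_monomial scalerAl.
rewrite -mulr_suml; apply: fps_congM => //.
apply: (@fps_congW _ _ d (5 * d)); first by rewrite leq_pmull.
by rewrite -{2}[g]fps_comp_id; apply/fps_cong_sym/fps_comp_sum.
Qed.

End Expectation.

(** * The Gaussian integral formula for the compositional inverse *)

Theorem theorem5 (R : comUnitAlgType rat) (n : nat) (n_ge1 : (1 <= n)%N)
    (F H : 'I_n -> {fps R[n]}) (A : 'M[R]_n)
    (F_const : forall i, F i 0%MM = 0)
    (A_def : A = jacobian0 F)
    (A_unit : A \in unitmx)
    (H_def : forall i, F i = \sum_(j < n) A i j *: fpsX j - H i)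
    (H_ge2 : forall i (m : 'X_{1..n}), (mdeg m < 2)%N -> H i m = 0) :
  let W : {fps R[n + (n + n)]} :=
    fps_exp (\sum_(i < n) ubar i * fps_comp (H i) uvar
             + \sum_(i < n) ubar i * Yvar i) in
  [/\ exists! G : 'I_n -> {fps R[n]}, compositional_inverse F G,
      gauss_integrable A W,
      forall i, gauss_integrable A (uvar i * W),
      gauss_integral A W \is a GRing.unit &
      forall G : 'I_n -> {fps R[n]}, compositional_inverse F G ->
        forall i, G i = gauss_integral A (uvar i * W) / gauss_integral A W].
Proof.
rewrite -/(exponent H) -/(weight H) => W.
(* Positive integers are units of R, being images of nonzero rationals. *)
have natU k : (k.+1%:R : R) \is a GRing.unit.
  rewrite -(rmorph_nat (in_alg R)) rmorph_unit // unitfE.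
  by rewrite Num.Theory.pnatr_eq0.
have H2 i : order_ge 2 (H i) by move=> m; rewrite -ltnNge; apply: H_ge2.
have u0 := @uvar_const n R.
have Z1 : gauss_integral A W = expectation H A 1.
  by rewrite /expectation fps_comp1 // mul1r.
have Zu : gauss_integral A W \is a GRing.unit.
  by rewrite Z1; apply: expectation1_unit.
split=> //.
- have [G FG] := compositional_inverse_exists A_unit H_def H2.
  by exists G; split=> // G'; apply: compositional_inverse_unique FG.
- by apply: balanced_integrable; apply: balanced_weight.
- move=> i; apply: balanced_integrable.
  by have := balanced_integrand H2 (fpsX i); rewrite fps_compX.
move=> G [G0 FG GF] i; apply: (canRL (mulrK Zu)).
(* For g = G_i one has g o F = X_i, so E(g o F) = g E(1) becomes E(X_i) = G_i E(1). *)
rewrite Z1 -(expectation_comp H2 natU A_unit H_def F_const) GF.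
by rewrite /expectation fps_compX.
Qed.
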